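(* Let $n\ge 2$ be an integer and let $k=1$ or $k=2$. The point $\rho_0\in\mathbb{C}\setminus\mathbb{R}$ is a singularity of the curve $B_n^{(k)}$ if and only if $K_n(\rho_0)$ possesses a type-$k$ borderline/double eigenvalue.
   Context: For an integer $n\ge 2$ and $\rho\in\mathbb{C}$, $K_n(\rho)=[\rho^{|j-k|}]_{j,k=1}^n$. An eigenvalue $\lambda$ of $K_n(\rho)$ is borderline if $|\lambda|=n$, and borderline/double if it is borderline and also an eigenvalue of algebraic multiplicity $2$. A vector $y\in\mathbb{C}^n$ is symmetric if $y_{n+1-j}=y_j$ for all $j$, and skew-symmetric if $y_{n+1-j}=-y_j$ for all $j$. An eigenvalue of $K_n(\rho)$ is of type-1 if it has a nonzero skew-symmetric eigenvector, and of type-2 if it has a nonzero symmetric eigenvector. For $u\in[-\pi,\pi]$ let $g_n(u)=n^2\sin^2u-\sin^2(nu)$, let $v(n,u)$ be the unique root $v\ge 0$ of $\sinh^2(nv)-n^2\sinh^2v=g_n(u)$, let $\mu(n,u)=u+i\,v(n,u)$, and let $$f_n^{(1)}(u)=\frac{\sin\frac{(n+1)\mu(n,u)}{2}}{\sin\frac{(n-1)\mu(n,u)}{2}},\qquad f_n^{(2)}(u)=\frac{\cos\frac{(n+1)\mu(n,u)}{2}}{\cos\frac{(n-1)\mu(n,u)}{2}},$$ where quotients $0/0$ (possible only at $u=0,\pm\pi$) are understood as removable singularities in $\mu$, i.e. by their limiting values. The function $f_n^{(k)}$ takes real values only at $u=0,\pm\pi$ and is differentiable on $(-\pi,0)\cup(0,\pi)$.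 The curve $B_n^{(k)}$ is the closed curve $\{f_n^{(k)}(u):u\in[-\pi,\pi]\}$ with parametrization $f_n^{(k)}$. A point $\rho_0\in\mathbb{C}\setminus\mathbb{R}$ is a singularity of $B_n^{(k)}$ if $\rho_0=f_n^{(k)}(u_0)$ for some $u_0$ with $\frac{df_n^{(k)}}{du}(u_0)=0$. *)

(* Defs.v *)
From HB Require Import structures.
From mathcomp Require Import all_boot all_order all_algebra.
From mathcomp Require Import complex.
From mathcomp Require Import all_classical all_reals all_analysis.

Set Implicit Arguments.
Unset Strict Implicit.
Unset Printing Implicit Defensive.

Import Order.TTheory GRing.Theory Num.Theory.
Import numFieldNormedType.Exports.

Local Open Scope classical_set_scope.
Local Open Scope ring_scope.
Local Open Scope complex_scope.

Section Functions.
Variable R : realType.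
Local Notation C := R[i].

Definition sinh (x : R) : R := (expR x - expR (- x)) / 2.

Definition expC (z : C) : C :=
  (expR (complex.Re z))%:C * (cos (complex.Im z) +i* sin (complex.Im z)).
Definition sinC (z : C) : C := (expC ('i * z) - expC (- ('i * z))) / (2 * 'i).
Definition cosC (z : C) : C := (expC ('i * z) + expC (- ('i * z))) / 2.

Definition g_n (n : nat) (u : R) : R :=
  n%:R ^+ 2 * sin u ^+ 2 - sin (n%:R * u) ^+ 2.

(* For n >= 2 and every u this set is a singleton, so the default value 0 of
   xget is never used. *)
Definition v_n (n : nat) (u : R) : R :=
  xget 0 [set x : R | 0 <= x /\
    sinh (n%:R * x) ^+ 2 - n%:R ^+ 2 * sinh x ^+ 2 = g_n n u].

Definition mu_n (n : nat) (u : R) : C := u +i* v_n n u.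

(* The sine for k = 1 and the cosine for k = 2; other values of k are unused. *)
Definition trig (k : nat) : C -> C := if k == 1%N then sinC else cosC.

Definition f_num (k n : nat) (z : C) : C := trig k ((n%:R + 1) * z / 2).
Definition f_den (k n : nat) (z : C) : C := trig k ((n%:R - 1) * z / 2).

(* R[i]^o carries the topology of the complex plane, so the limit in the first
   branch is a limit in the complex variable w. *)
Definition f_ratio (k n : nat) (z : C) : C :=
  if (f_num k n z == 0) && (f_den k n z == 0)
  then lim ((f_num k n w / f_den k n w : C^o) @[w --> (z : C^o)^'])
  else f_num k n z / f_den k n z.

Definition f_n (k n : nat) (u : R) : C := f_ratio k n (mu_n n u).

(* phi is differentiable at u, with derivative l, as a complex-valued function
   of a real variable. *)
Definition has_derivative (phi : R -> C) (u : R) (l : C) : Prop :=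
  ((phi (u + h) - phi u) / h%:C : C^o) @[h --> (0 : R)^'] --> (l : C^o).

(* The two-sided derivative is also required at u0 = 0, pi, -pi, but there
   f_n k n is real-valued, so this does not matter for a non-real rho0. *)
Definition is_singularity (k n : nat) (rho0 : C) : Prop :=
  exists u0 : R, [/\ - pi <= u0 <= pi, f_n k n u0 = rho0
                   & has_derivative (f_n k n) u0 0].

End Functions.

Section Matrix.
Variables (R : realType) (n : nat).
Local Notation C := R[i].

Definition K_n (rho : C) : 'M[C]_n := \matrix_(j, k) rho ^+ `|j - k|%N.

Definition borderline (rho lambda : C) : Prop :=
  eigenvalue (K_n rho) lambda /\ `|lambda| = n%:R.

Definition borderline_double (rho lambda : C) : Prop :=
  borderline rho lambda /\ mup lambda (char_poly (K_n rho)) = 2%N.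

Definition symmetric_vec (y : 'cV[C]_n) : Prop :=
  forall j, y (rev_ord j) 0 = y j 0.
Definition skew_symmetric_vec (y : 'cV[C]_n) : Prop :=
  forall j, y (rev_ord j) 0 = - y j 0.

(* Type 1 for k = 1 and type 2 for k = 2; other values of k are unused. *)
Definition of_type (k : nat) (rho lambda : C) : Prop :=
  exists y : 'cV[C]_n,
    [/\ y != 0, K_n rho *m y = lambda *: y
      & if k == 1%N then skew_symmetric_vec y else symmetric_vec y].

End Matrix.

(* Main.v *)
Require Import Defs.
From mathcomp Require Import all_boot all_order all_algebra.
From mathcomp Require Import complex ring lra zify.
From mathcomp Require Import all_classical all_reals all_analysis.

(** Everything is read off in the variable [w = e^(i mu)], with a sign
    [e = 1] for [k = 1] (sine, skew-symmetric vectors) and [e = -1] for [k = 2]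
    (cosine, symmetric vectors).

    The function of the curve becomes [f = (w^(n+1) - e) / (w^n - e w)], so
    [rho = f] says that [w] is a root of the polynomial
    [A_e = w^n (w - rho) - e (1 - rho w)] ([secular]).  On the matrix side,
    [lambda = (1 - rho^2) w / ((1 - rho w)(w - rho))] parametrizes the possible
    eigenvalues, because the inverse of [K_n(rho)] is tridiagonal up to a factor
    and its three-term recurrence is solved by the powers of [w] and [1/w].
    A determinant computation gives the polynomial identity
    [prod_i (N - lambda_i D) (w^2 - 1) = c A_1 A_(-1)] ([kms_secular_poly]),
    with [lambda_i] the eigenvalues and [N / D] the parametrization.  As
    [N - lambda D] has simple roots [w], [1/w] when [w^2 <> 1], the algebraic
    multiplicity of [lambda] is the sum of the multiplicities of [w] as a root of
    [A_1] and of [A_(-1)] ([mup_kms_secular]).  These two have no common root,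
    a root of [A_e] yields an eigenvector of the parity of [e]
    ([secular_eigenvector]), and a root of multiplicity three would force
    [w^2 = 1] ([secular_double_root_exact]).  Hence [lambda] is a type-[k] double
    eigenvalue exactly when [w] is a double root of [A_e].  The points [w = 1]
    and [w = -1] belong to no eigenvalue, since [A_1 A_(-1)] has a simple root
    there when [rho] is not real ([root_kms_param]).

    A root [w = e^(i (u + i v))] of [A_e] satisfies
    [lambda = - e sin(n mu) / sin mu], so [|lambda| = n] is the equation that
    defines [v(n,u)] ([borderline_iff]); the choice [|w| <= 1] makes [v >= 0].

    It remains to see when the curve is singular.  If [A_e = (X - w0) q], then
    [f(u) - rho = q(w) (w - w0) / (w^n - e w)] along [w = w(u)], and [w(u)] has a
    nonzero derivative because [v(n,u)] is differentiable where [sin u <> 0].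
    So [f' = 0] if and only if [q(w0) = 0] ([f_n_derivative]), that is, if and
    only if [w0] is a double root of [A_e].  At a point where [sin u = 0] or the
    quotient degenerates, [f] is real ([f_n_nonreal]). *)

Set Implicit Arguments.
Unset Strict Implicit.
Unset Printing Implicit Defensive.

Import Order.TTheory GRing.Theory Num.Theory.
Import numFieldNormedType.Exports.
Local Open Scope ring_scope.

(** * Tridiagonal Toeplitz matrices with modified corners *)
Section Tridiagonal.
Variable F : fieldType.

(** The corner entries are [b - r] (and [b - 2 r] when [n = 1]).  Writing each
    entry as a sum of indicators makes products with vectors sums of deltas. *)
Definition tridiag n (a b r : F) : 'M[F]_n :=
  \matrix_(i, j) (b *+ (i == j :> nat) - a *+ (i.+1 == j) - a *+ (j.+1 == i)
                  - r *+ ((i == 0%N :> nat) && (j == 0%N :> nat))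
                  - r *+ ((i.+1 == n) && (j.+1 == n))).

Lemma sum_mulrb_ord n (f : nat -> F) (k : nat) :
  \sum_(j < n) f j *+ (k == j :> nat) = f k *+ (k < n)%N.
Proof.
have [kn|nk] := ltnP k n; last first.
  by rewrite big1 // => j _; case: eqP => // kj; move: nk; rewrite kj leqNgt ltn_ord.
rewrite (bigD1 (Ordinal kn)) //= eqxx big1 ?addr0 // => j.
by rewrite -val_eqE /= eq_sym => /negPf ->.
Qed.

(** The vector is the restriction to [1, n] of a sequence [x] whose ghost
    entries [x 0] and [x n.+1] absorb the corners: with [a x_0 = r x_1] the first
    row looks like an interior row, and the last one does up to the displayed
    defect. *)
Lemma tridiag_row n a b r (x : nat -> F) (i : 'I_n) :
  a * x 0%N = r * x 1%N ->
  \sum_j tridiag n a b r i j * x j.+1 =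
  b * x i.+1 - a * x i - a * x i.+2 + (a * x n.+1 - r * x n) *+ (i.+1 == n).
Proof.
move=> x0; have n0 : (0 < n)%N by case: (i) => ? /=; lia.
have E (j : 'I_n) : tridiag n a b r i j * x j.+1 =
    (b * x j.+1) *+ (i == j :> nat) - (a * x j.+1) *+ (i.+1 == j)
    - (a * x j.+1) *+ (i.-1 == j :> nat) *+ (0 < i)%N
    - (r * x j.+1) *+ (0%N == j :> nat) *+ (i == 0%N :> nat)
    - (r * x j.+1) *+ (n.-1 == j :> nat) *+ (i.+1 == n).
  rewrite mxE !mulrBl !mulrnAl; congr (_ - _ - _ - _ - _).
  - by rewrite -mulrnA mulnb; congr (_ *+ _); lia.
  - by rewrite -mulrnA mulnb; congr (_ *+ _); lia.
  - by rewrite -mulrnA mulnb; congr (_ *+ _); lia.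
under eq_bigr do rewrite E.
transitivity (b * x i.+1 - (a * x i.+2) *+ (i.+1 < n)%N
    - (a * x i.-1.+1) *+ (0 < i)%N - (r * x 1%N) *+ (i == 0%N :> nat)
    - (r * x n) *+ (i.+1 == n)).
  rewrite !sumrB !sumrMnl !(sum_mulrb_ord _ (fun j => _ * x j.+1)) ltn_ord n0.
  have -> : (i.-1 < n)%N by have := ltn_ord i; lia.
  have -> : (n.-1 < n)%N by lia.
  by rewrite (prednK n0) !mulr1n.
have [i0|i0] := eqVneq (i : nat) 0%N.
  rewrite i0 /= -x0; have [n1|n1] := eqVneq 1%N n.
    by rewrite -n1 ltnn /= !mulr1n !mulr0n; ring.
  have -> : (1 < n)%N by lia.
  by rewrite mulr1n !mulr0n; ring.
have ig : (0 < i)%N by lia.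
rewrite ig prednK //; have [n1|n1] := eqVneq i.+1 n.
  by rewrite n1 ltnn /= !mulr1n !mulr0n; ring.
have -> : (i.+1 < n)%N by have := ltn_ord i; lia.
by rewrite !mulr1n !mulr0n; ring.
Qed.

(** Each row determines the next entry of an eigenvector from the previous ones,
    so the eigenspaces are lines on which the first entry does not vanish. *)
Lemma tridiag_mulmx_eq0 n a b r (y : 'cV[F]_n) c (n0 : (0 < n)%N) : a != 0 ->
  tridiag n a b r *m y = c *: y -> y (Ordinal n0) 0 = 0 -> y = 0.
Proof.
move=> a0 Ty y0.
suff H k : forall i : 'I_n, (i <= k)%N -> y i 0 = 0.
  by apply/colP => i; rewrite (H n i) ?mxE // ltnW.
elim/ltn_ind: k => k IH i ik.
have [|ik'] := ltnP i k; first by move=> h; exact: (IH i).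
case: k IH ik ik' => [|k] IH ik ik'.
  by rewrite (_ : i = Ordinal n0) //; apply: val_inj => /=; lia.
have kn : (k < n)%N by have := ltn_ord i; lia.
have := congr1 (fun z : 'cV_n => z (Ordinal kn) 0) Ty.
rewrite !mxE (IH k _ (Ordinal kn)) // mulr0 (bigD1 i) //= big1 => [|j ji].
  rewrite addr0 mxE /=.
  have -> : (k == i :> nat) = false by lia.
  have -> : (k.+1 == i :> nat) = true by lia.
  have -> : (i.+1 == k :> nat) = false by lia.
  have -> : ((k == 0) && (i == 0 :> nat))%N = false by lia.
  have -> : ((k.+1 == n) && (i.+1 == n :> nat))%N = false by have := ltn_ord i; lia.
  rewrite !mulr0n mulr1n !subr0 sub0r => /eqP.
  by rewrite mulf_eq0 oppr_eq0 (negPf a0) => /eqP.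
have [jk|jk] := leqP j k; first by rewrite (IH k) // mulr0.
rewrite mxE /=.
have ji' : (j != i :> nat) by [].
have -> : (k == j :> nat) = false by lia.
have -> : (k.+1 == j :> nat) = false by lia.
have -> : (j.+1 == k :> nat) = false by lia.
have -> : ((k == 0) && (j == 0 :> nat))%N = false by lia.
have -> : ((k.+1 == n) && (j.+1 == n :> nat))%N = false.
  by have := ltn_ord i; have := ltn_ord j; lia.
by rewrite !mulr0n !subr0 mul0r.
Qed.

(** Replacing the first column by a solution [x] of the recurrence multiplies the
    determinant by [x 1] and leaves in that column only the defect of the last
    row; the complementary minor is triangular with [- a] on its diagonal. *)
Lemma det_tridiag m a b r (x : nat -> F) : a * x 0%N = r * x 1%N ->
  (forall i, (i <= m)%N -> b * x i.+1 = a * x i + a * x i.+2) ->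
  \det (tridiag m.+1 a b r) * x 1%N = a ^+ m * (a * x m.+2 - r * x m.+1).
Proof.
move=> x0 rec.
pose W : 'M[F]_m.+1 := \matrix_(i, j) (if j == 0 then x i.+1 else (i == j)%:R).
have dW : \det W = x 1%N.
  rewrite (@det_trig _ _ W); last first.
    apply/is_trig_mxP => i j ij; rewrite mxE -!val_eqE /=.
    by rewrite [j == _ :> nat]gtn_eqF ?(leq_ltn_trans _ ij) // ltn_eqF.
  by rewrite big_ord_recl mxE /= big1 ?mulr1 // => i _; rewrite mxE /= eqxx.
rewrite -dW -det_mulmx.
have MW i j : (tridiag m.+1 a b r *m W) i j =
    if j == 0 then (a * x m.+2 - r * x m.+1) *+ (i == m :> nat)
    else tridiag m.+1 a b r i j.
  rewrite mxE; have [->|j0] := eqVneq j 0.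
    under eq_bigr do rewrite [W _ _]mxE eqxx.
    by rewrite tridiag_row // rec ?eqSS -1?ltnS //; ring.
  under eq_bigr do rewrite [W _ _]mxE (negPf j0) mulr_natr.
  rewrite (bigD1 j) //= eqxx mulr1n big1 ?addr0 // => k /negPf ->.
  by rewrite mulr0n.
rewrite (expand_det_col _ 0) (bigD1 ord_max) //= big1 ?addr0 => [|i ni].
  rewrite MW eqxx /= eqxx mulr1n mulrC; congr (_ * _).
  have minor i j : row' ord_max (col' 0 (tridiag m.+1 a b r *m W)) i j =
      tridiag m.+1 a b r (lift ord_max i) (lift 0 j).
    by rewrite [LHS]mxE [LHS]mxE MW (_ : lift 0 j == 0 = false).
  rewrite /cofactor addn0 (@det_trig _ _ (row' _ _)); last first.
    apply/is_trig_mxP => i j ij; rewrite minor mxE /= /bump /= add1n.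
    have im := ltn_ord i; have jm := ltn_ord j.
    have -> : (m <= i)%N = false by lia.
    rewrite /= add0n.
    have -> : (i == j.+1 :> nat) = false by lia.
    have -> : (i.+1 == j.+1 :> nat) = false by lia.
    have -> : (j.+2 == i :> nat) = false by lia.
    have -> : ((i == 0 :> nat) && (j.+1 == 0))%N = false by lia.
    have -> : ((i.+1 == m.+1 :> nat) && (j.+2 == m.+1))%N = false by lia.
    by rewrite !mulr0n !subr0.
  rewrite (eq_bigr (fun=> - a)) => [|i _]; last first.
    rewrite minor mxE /= /bump /= add1n.
    have im := ltn_ord i.
    have -> : (m <= i)%N = false by lia.
    rewrite /= add0n eqxx.
    have -> : (i == i.+1 :> nat) = false by lia.
    have -> : (i.+2 == i :> nat) = false by lia.
    have -> : ((i == 0 :> nat) && (i.+1 == 0))%N = false by lia.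
    have -> : ((i.+1 == m.+1 :> nat) && (i.+2 == m.+1))%N = false by lia.
    by rewrite !mulr0n !subr0 mulr1n sub0r.
  by rewrite prodr_const card_ord -exprMn mulN1r opprK.
rewrite MW eqxx (_ : (i == m :> nat) = false) ?mul0r //.
by apply/negbTE; rewrite -val_eqE in ni.
Qed.
End Tridiagonal.

(** * The inverse of the Kac-Murdock-Szego matrix *)
Section KMS.
Variables (F : fieldType) (n : nat) (rho : F).

Definition kms : 'M[F]_n := \matrix_(j, k) rho ^+ `|j - k|%N.

Local Notation T := (tridiag n rho (1 + rho ^+ 2) (rho ^+ 2)).

Lemma tridiag_mul_kms : T *m kms = (1 - rho ^+ 2)%:M.
Proof.
apply/matrixP => i j; rewrite [LHS]mxE [RHS]mxE.
pose x (l : nat) : F := rho ^+ `|l - j.+1|%N.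
have E k : T i k * kms k j = T i k * x k.+1.
  by rewrite [kms _ _]mxE /x (_ : `|k - j| = `|k.+1 - j.+1|)%N //; lia.
have [jn i_n] := (ltn_ord j, ltn_ord i).
have x0 : rho * x 0%N = rho ^+ 2 * x 1%N.
  rewrite /x (_ : `|0 - j.+1|%N = `|1 - j.+1|.+1%N); last by lia.
  by rewrite exprS mulrA expr2.
have xn : rho * x n.+1 = rho ^+ 2 * x n.
  rewrite /x (_ : `|n.+1 - j.+1|%N = `|n - j.+1|.+1%N); last by lia.
  by rewrite exprS mulrA expr2.
under eq_bigr do rewrite E.
rewrite tridiag_row // xn subrr mul0rn addr0 /x -val_eqE /=.
have [ij|ji|ij] := ltngtP i j.
- have -> : `|i - j.+1|%N = (j - i).+1 by lia.
  have -> : `|i.+1 - j.+1|%N = (j - i)%N by lia.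
  have -> : `|i.+2 - j.+1|%N = (j - i).-1 by lia.
  have -> : (j - i)%N = (j - i).-1.+1 by lia.
  by rewrite /= !exprS; ring.
- have -> : `|i - j.+1|%N = (i - j).-1 by lia.
  have -> : `|i.+1 - j.+1|%N = (i - j)%N by lia.
  have -> : `|i.+2 - j.+1|%N = (i - j).+1 by lia.
  have -> : (i - j)%N = (i - j).-1.+1 by lia.
  by rewrite /= !exprS; ring.
- rewrite ij.
  have -> : `|j - j.+1|%N = 1%N by lia.
  have -> : `|j.+1 - j.+1|%N = 0%N by lia.
  have -> : `|j.+2 - j.+1|%N = 1%N by lia.
  by rewrite expr0 expr1 mulr1n; ring.
Qed.

Hypothesis rho21 : rho ^+ 2 != 1.

Let rho12 : 1 - rho ^+ 2 != 0. Proof. by rewrite subr_eq0 eq_sym. Qed.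

Lemma kms_mul_tridiag : kms *m T = (1 - rho ^+ 2)%:M.
Proof.
have := mulmx1C (_ : ((1 - rho ^+ 2)^-1 *: T) *m kms = 1%:M).
rewrite -!scalemxAl -scalemxAr tridiag_mul_kms -mul_scalar_mx -scalar_mxM mulVf //.
move=> /(_ erefl) /(congr1 ( *:%R (1 - rho ^+ 2))).
by rewrite scalerA mulfV // scale1r => ->; rewrite scale_scalar_mx mulr1.
Qed.

Lemma det_tridiag_neq0 : \det T != 0.
Proof.
have /(congr1 determinant) := tridiag_mul_kms.
rewrite det_mulmx det_scalar => TK; apply: contra_eqN TK => /eqP ->.
by rewrite mul0r eq_sym expf_neq0.
Qed.

Lemma kms_eigen_tridiag (y : 'cV[F]_n) lam th : lam * th = 1 - rho ^+ 2 ->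
  kms *m y = lam *: y <-> T *m y = th *: y.
Proof.
move=> lt; have l0 : lam != 0.
  by apply: contraNneq rho12 => l0; rewrite -lt l0 mul0r.
split=> [Ky|Ty].
  have := tridiag_mul_kms => /(congr1 (mulmxr y)) /=.
  rewrite -mulmxA Ky -scalemxAr mul_scalar_mx -lt -scalerA.
  by move/(scalerI l0).
have := kms_mul_tridiag => /(congr1 (mulmxr y)) /=.
rewrite -mulmxA Ty -scalemxAr mul_scalar_mx -lt mulrC -scalerA.
by apply: scalerI; apply: contraNneq rho12 => t0; rewrite -lt t0 mulr0.
Qed.

(** With [lambda = (1 - rho^2) w / ((1 - rho w)(w - rho))], this is the matrix
    [lambda T - (1 - rho^2)] up to a scalar; its off-diagonal entry [- w] and
    diagonal entry [1 + w^2] give a recurrence solved by [w^j] and [w^-j]. *)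
Lemma tridiag_shift w :
  w *: T - ((1 - rho * w) * (w - rho))%:M =
  rho *: tridiag n w (1 + w ^+ 2) (rho * w).
Proof.
apply/matrixP => i j; rewrite !mxE -val_eqE /=.
case: (_ == _); case: (_ == _); case: (_ == _);
by case: (_ && _); case: (_ && _); rewrite ?mulr0n ?mulr1n; ring.
Qed.
End KMS.

(** * The characteristic polynomial in the variable w *)
Section Characteristic.
Variables (F : fieldType) (n : nat) (rho : F).

(** The eigenvalue [(1 - rho^2) / (1 - 2 rho cos mu + rho^2)] is the quotient of
    [lam_num] by [lam_den] at [w = e^(i mu)]. *)
Definition lam_num : {poly F} := (1 - rho ^+ 2) *: 'X.
Definition lam_den : {poly F} := (1 - rho *: 'X) * ('X - rho%:P).
(** In terms of [mu] and for [e = 1] this is, up to a nonvanishing factor,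
    [sin((n+1)mu/2) - rho sin((n-1)mu/2)]; for [e = -1] cosines replace sines. *)
Definition secular (e : F) : {poly F} :=
  'X^n * ('X - rho%:P) - e *: (1 - rho *: 'X).

Lemma horner_lam_num w : lam_num.[w] = (1 - rho ^+ 2) * w.
Proof. by rewrite !hornerE. Qed.

Lemma horner_lam_den w : lam_den.[w] = (1 - rho * w) * (w - rho).
Proof. by rewrite !hornerE. Qed.

Lemma horner_secular e w :
  (secular e).[w] = w ^+ n * (w - rho) - e * (1 - rho * w).
Proof. by rewrite !hornerE. Qed.

(** The solution of the recurrence that fits the first row is
    [(w - rho) w^j - (1 - rho w) w^(1-j)], and its defect in the last row is
    [A_1 A_(-1)] up to a power of [w]. *)
Lemma det_tridiag_secular w : (0 < n)%N -> w != 0 ->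
  \det (tridiag n w (1 + w ^+ 2) (rho * w)) * (w ^+ 2 - 1) =
  (secular 1 * secular (- 1)).[w].
Proof.
rewrite hornerM !horner_secular.
case: n => // m _ w0.
(* The extra factor w^n keeps all exponents nonnegative. *)
pose x (j : nat) := (w - rho) * w ^+ (m.+1 + j) - (1 - rho * w) * w ^+ (m.+2 - j).
have x0 : w * x 0%N = rho * w * x 1%N.
  by rewrite /x addn0 addn1 subn0 subn1 /= !exprS; ring.
have xS i : (i <= m)%N -> (1 + w ^+ 2) * x i.+1 = w * x i + w * x i.+2.
  move=> im; rewrite /x.
  have -> : (m.+2 - i = (m - i).+2)%N by lia.
  have -> : (m.+2 - i.+1 = (m - i).+1)%N by lia.
  have -> : (m.+2 - i.+2 = m - i)%N by lia.
  by rewrite !addnS !addSn !exprS; ring.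
have := det_tridiag x0 xS.
have -> : x 1%N = w ^+ m.+1 * (w ^+ 2 - 1).
  by rewrite /x addn1 subn1 /= !exprS; ring.
rewrite mulrCA => H; apply: (@mulfI _ (w ^+ m.+1)); first by rewrite expf_neq0.
by rewrite H /x subnn subSnn !addnS !addSn !exprS !exprD expr0; ring.
Qed.

Hypothesis rho21 : rho ^+ 2 != 1.

Lemma char_poly_kms_secular (s : seq F) w : (0 < n)%N ->
  char_poly (kms n rho) = \prod_(l <- s) ('X - l%:P) ->
  w != 0 -> lam_den.[w] != 0 ->
  \det (tridiag n rho (1 + rho ^+ 2) (rho ^+ 2))
    * ((\prod_(l <- s) (lam_num - l *: lam_den)).[w] * (w ^+ 2 - 1)) =
  ((1 - rho ^+ 2) * rho) ^+ n * (secular 1 * secular (- 1)).[w].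
Proof.
move=> n0 ps w0 D0; set T := tridiag _ _ _ _.
have szs : size s = n.
  by apply: succn_inj; rewrite -(size_char_poly (kms n rho)) ps size_prod_XsubC.
rewrite -det_tridiag_secular // !mulrA; congr (_ * _).
have -> : (\prod_(l <- s) (lam_num - l *: lam_den)).[w] =
    \det (lam_num.[w]%:M - lam_den.[w] *: kms n rho).
  set x := lam_num.[w] / lam_den.[w].
  have -> : lam_num.[w]%:M - lam_den.[w] *: kms n rho =
      lam_den.[w] *: (x%:M - kms n rho).
    by rewrite scalerBr scale_scalar_mx /x [_ * (_ / _)]mulrC divfK.
  rewrite detZ.
  have -> : \det (x%:M - kms n rho) = (char_poly (kms n rho)).[x].
    rewrite -horner_evalE -det_map_mx; congr (\det _).
    by apply/matrixP => i j; rewrite !mxE /= /horner_eval !hornerE hornerMn hornerX.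
  rewrite ps !horner_prod -{1}szs.
  have -> : lam_den.[w] ^+ size s = \prod_(l <- s) lam_den.[w].
    by rewrite big_const_seq count_predT iter_mulr mulr1.
  rewrite -big_split /=; apply: eq_bigr => l _.
  rewrite !hornerD !hornerN [(l *: _).[_]]hornerZ hornerX hornerC mulrBr.
  by rewrite /x mulrCA divff // mulr1 [l * _]mulrC.
rewrite mulrC -det_mulmx mulmxBl -scalemxAl kms_mul_tridiag //.
have -> : lam_num.[w]%:M *m T - lam_den.[w] *: (1 - rho ^+ 2)%:M =
    ((1 - rho ^+ 2) * rho) *: tridiag n w (1 + w ^+ 2) (rho * w).
  rewrite -scalerA -tridiag_shift mul_scalar_mx -/T scalerBr scalerA.
  by rewrite !scale_scalar_mx horner_lam_num horner_lam_den [_ * (1 - _ ^+ 2)]mulrC.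
by rewrite detZ.
Qed.
End Characteristic.

(** * Multiplicities of roots *)
Section Multiplicity.
Variable F : fieldType.
Implicit Types p q : {poly F}.

Lemma mup_ge2 x p : p != 0 -> (2 <= mup x p)%N -> root p x /\ root p^`() x.
Proof.
move=> p0; rewrite mup_geq // => /dvdpP[r ->].
rewrite /root expr2 !derivM derivXsubC !(hornerXsubC, hornerM, hornerD) subrr.
by rewrite !(mulr0, mul0r, addr0).
Qed.

Lemma mup_ge3 x p : p != 0 -> (3 <= mup x p)%N -> root p^`()^`() x.
Proof.
move=> p0; rewrite mup_geq // => /dvdpP[r ->].
rewrite /root !exprS expr0 mulr1.
rewrite !(derivXsubC, derivM, derivD).
by rewrite !(hornerXsubC, hornerM, hornerD) subrr !(mulr0, mul0r, addr0).
Qed.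

Lemma mup_prod_seq (I : eqType) (s : seq I) (P : I -> {poly F}) x :
  {in s, forall i, P i != 0} ->
  mup x (\prod_(i <- s) P i) = (\sum_(i <- s) mup x (P i))%N.
Proof.
elim: s => [|i s IH] P0; first by rewrite !big_nil mupNroot // root1.
have Ps : {in s, forall j, P j != 0}.
  by move=> j js; apply: P0; rewrite in_cons js orbT.
rewrite !big_cons mupM ?IH ?P0 ?mem_head // prodf_seq_neq0.
by apply/allP => j js; rewrite Ps.
Qed.
End Multiplicity.

(** * Eigenvalues and eigenvectors through the secular polynomials *)

(** In characteristic zero the naturals supply enough points off the roots of [r]. *)
Lemma poly_eq_off_roots (F : numDomainType) (p q r : {poly F}) : r != 0 ->
  (forall x, r.[x] != 0 -> p.[x] = q.[x]) -> p = q.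
Proof.
move=> r0 pq; apply/eqP; rewrite -subr_eq0; apply/negPn/negP => d0.
have := @max_poly_roots _ (r * (p - q)) [seq i%:R | i <- iota 0 (size (r * (p - q)))].
rewrite mulf_neq0 // size_map size_iota ltnn => /(_ isT) H.
suff : false by []; apply: H.
  apply/allP => _ /mapP[i _ ->]; rewrite /root hornerM hornerD hornerN.
  by have [->|/pq ->] := eqVneq r.[i%:R] 0; rewrite ?subrr ?mul0r ?mulr0.
by rewrite map_inj_uniq ?iota_uniq // => i j /eqP; rewrite eqr_nat => /eqP.
Qed.

Section KMSMultiplicity.
Variables (C : numClosedFieldType) (n : nat) (rho : C).
Hypotheses (n2 : (2 <= n)%N) (rho0 : rho != 0) (rho21 : rho ^+ 2 != 1).
Local Notation N := (lam_num rho).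
Local Notation D := (lam_den rho).
Local Notation A := (secular n rho).

Let rho12 : 1 - rho ^+ 2 != 0. Proof. by rewrite subr_eq0 eq_sym. Qed.

Lemma lam_den_neq0 : D != 0.
Proof.
apply: contraNneq rho0 => /(congr1 (horner^~ 0)).
by rewrite horner_lam_den !hornerE => /eqP; rewrite !(mulr0,subr0,mul1r,sub0r) oppr_eq0.
Qed.

(** [w] and [1/w] give the same eigenvalue, since [1 - 2 rho cos mu + rho^2] is
    even in [mu]. *)
Lemma lam_pencil_factor l w : w != 0 -> l * D.[w] = N.[w] ->
  N - l *: D = (l * rho) *: (('X - w%:P) * ('X - w^-1%:P)).
Proof.
move=> w0; rewrite horner_lam_num horner_lam_den => lw.
have -> : N - l *: D = (l * rho) *: 'X^2
    + (1 - rho ^+ 2 - l * (1 + rho ^+ 2)) *: 'X + (l * rho)%:P.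
  rewrite /lam_num /lam_den -!mul_polyC.
  by rewrite !(rmorphM, rmorphB, rmorphD, rmorphXn, rmorph1) /=; ring.
have -> : (1 - rho ^+ 2 - l * (1 + rho ^+ 2)) = - (l * rho) * (w + w^-1).
  apply: (mulIf w0); rewrite -[RHS]mulrA [(_ + _) * w in RHS]mulrDl mulVf //.
  by rewrite mulrBl -lw; ring.
rewrite -!mul_polyC !(rmorphM, rmorphB, rmorphD, rmorphN, rmorphXn, rmorph1) /=.
have ww : (w%:P * (w^-1)%:P = 1 :> {poly C}) by rewrite -rmorphM mulfV.
transitivity ((l%:P * rho%:P) * ('X^2 - (w%:P + w^-1%:P) * 'X + 1)); first by ring.
by rewrite -ww; ring.
Qed.

Lemma lam_pencil_neq0 l : l != 0 -> N - l *: D != 0.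
Proof.
move=> l0; apply: contraNneq l0 => /(congr1 (horner^~ 0)) /eqP.
rewrite horner0 !(horner_lam_num, horner_lam_den, hornerD, hornerN, hornerZ).
by rewrite !(mulr0,subr0,mul1r,sub0r) mulrN opprK mulf_eq0 (negPf rho0) orbF.
Qed.

Lemma eigenvalue_kms_neq0 l : root (char_poly (kms n rho)) l -> l != 0.
Proof.
rewrite -eigenvalue_root_char => /eigenvalueP[v vK]; apply: contra_neq => l0.
have := congr1 (mulmx v) (kms_mul_tridiag n rho21).
rewrite mulmxA vK l0 scale0r mul0mx mul_mx_scalar => /esym/eqP.
by rewrite scaler_eq0 (negPf rho12) => /eqP.
Qed.

Lemma kms_secular_poly : exists2 c, c != 0 & exists2 s : seq C,
  char_poly (kms n rho) = \prod_(l <- s) ('X - l%:P) &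
  (\prod_(l <- s) (N - l *: D)) * ('X^2 - 1) = c *: (A 1 * A (-1)).
Proof.
have [s ps] := closed_field_poly_normal (char_poly (kms n rho)).
move: ps; rewrite (monicP (char_poly_monic _)) scale1r => ps.
have dT := det_tridiag_neq0 n rho21.
exists (((1 - rho ^+ 2) * rho) ^+ n / \det (tridiag n rho (1 + rho ^+ 2) (rho ^+ 2))).
  by rewrite mulf_neq0 ?invr_eq0 // expf_neq0 // mulf_neq0.
exists s => //; apply: (@poly_eq_off_roots _ _ _ ('X * D)).
  by rewrite mulf_neq0 ?polyX_eq0 // lam_den_neq0.
move=> w; rewrite hornerM hornerX mulf_eq0 negb_or => /andP[w0 D0].
apply: (mulfI dT); rewrite hornerM hornerD hornerN hornerXn hornerC.
rewrite char_poly_kms_secular // ?(ltnW n2) //.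
by rewrite hornerZ mulrA [_ * (_ / _)]mulrC divfK.
Qed.

Lemma secular_mulE : A 1 * A (-1) =
  'X^(n + n) * (('X - rho%:P) * ('X - rho%:P))
  - (1 - rho *: 'X) * (1 - rho *: 'X).
Proof. by rewrite /secular scale1r scaleN1r exprD; ring. Qed.

Lemma secular_mul_deriv w : w ^+ 2 = 1 ->
  (A 1 * A (-1))^`().[w] = 2 * (w - rho) * (n.+1%:R - n.-1%:R * rho * w).
Proof.
move=> w2; rewrite secular_mulE.
rewrite !(derivXn, derivXsubC, derivB, derivM, derivC, derivZ, derivX).
rewrite !(hornerXn, hornerX, hornerC, hornerMn, hornerM, hornerD, hornerN, hornerZ).
have wn : w ^+ (n + n) = 1 by rewrite addnn -mul2n exprM w2 expr1n.
have -> : w ^+ (n + n).-1 = w.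
  have -> : (n + n).-1 = (2 * n.-1).+1 by lia.
  by rewrite exprS exprM w2 expr1n mulr1.
rewrite wn -[w *+ _]mulr_natr natrD -(prednK (ltnW n2)) /= -!natr1.
move: (n.-1%:R : C) => m; apply/eqP; rewrite -subr_eq0; apply/eqP.
transitivity ((w ^+ 2 - 1) * (2 * (m + 1) * (w - rho) - 2 * rho)); first by ring.
by rewrite w2 subrr mul0r.
Qed.

Lemma mup_lam_pencil (l w : C) : w != 0 -> l != 0 -> l * D.[w] = N.[w] ->
  mup w (N - l *: D) = (w ^+ 2 == 1).+1.
Proof.
move=> w0 l0 lw; rewrite (lam_pencil_factor w0 lw) -mul_polyC mupMr; last first.
  by rewrite rootC mulf_neq0.
rewrite mupM ?polyXsubC_eq0 // -(expr1 ('X - w%:P)) -(expr1 ('X - w^-1%:P)).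
rewrite !mup_XsubCX eqxx.
have -> : (w^-1 == w) = (w ^+ 2 == 1); last by case: (_ == _).
by rewrite -(inj_eq (mulfI w0)) mulfV // eq_sym.
Qed.

Lemma mup_sqrX_sub1 (w : C) : mup w ('X^2 - 1) = (w ^+ 2 == 1).
Proof.
have -> : 'X^2 - 1 = ('X - 1%:P) ^+ 1 * ('X - (- 1)%:P) ^+ 1 :> {poly C}.
  by rewrite !expr1 rmorphN rmorph1; ring.
rewrite mupM ?expr1 ?polyXsubC_eq0 //.
rewrite -(expr1 ('X - 1%:P)) -(expr1 ('X - (- 1)%:P)) !mup_XsubCX.
rewrite sqrf_eq1 ![_ == w]eq_sym.
have [->|w1] := eqVneq w 1; last by case: (_ == _).
suff -> : (1 == - 1 :> C) = false by [].
by apply/negbTE; rewrite -subr_eq0 opprK (_ : 1 + 1 = 2%:R) // pnatr_eq0.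
Qed.

(** Comparing the order of vanishing at [w] on both sides of [kms_secular_poly]:
    only the factors [N - lambda_i D] with [lambda_i = l] vanish, each once if
    [w <> 1/w] and twice otherwise, and [X^2 - 1] vanishes if [w = 1/w]. *)
Lemma mup_kms (w l : C) : w != 0 -> D.[w] != 0 -> l * D.[w] = N.[w] ->
  (mup l (char_poly (kms n rho)) * (w ^+ 2 == 1)%R.+1 + (w ^+ 2 == 1)%R)%N =
  mup w (A 1 * A (-1)).
Proof.
move=> w0 D0 lw; have [c c0 [s ps eqA]] := kms_secular_poly.
have l0 : l != 0.
  apply: contraTneq isT => l0; move/eqP: lw; rewrite l0 mul0r eq_sym horner_lam_num.
  by rewrite mulf_eq0 (negPf rho12) (negPf w0).
have s0 : {in s, forall k, N - k *: D != 0}.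
  move=> k ks; apply/lam_pencil_neq0/eigenvalue_kms_neq0.
  by rewrite ps root_prod_XsubC.
have X0 : 'X^2 - 1 != 0 :> {poly C} by rewrite -size_poly_gt0 size_XnsubC.
have -> : mup w (A 1 * A (-1)) = mup w (c *: (A 1 * A (-1))).
  by rewrite -mul_polyC [RHS]mupMr // rootC.
rewrite -eqA mupM //; last first.
  by rewrite prodf_seq_neq0; apply/allP => k /s0 ->.
rewrite mup_sqrX_sub1; congr (_ + _)%N.
rewrite mup_prod_seq // ps mu_prod_XsubC -sum1_count big_distrl /= big_mkcond /=.
rewrite [RHS]big_seq [LHS]big_seq; apply: eq_bigr => k ks.
have [->|kl] := eqVneq k l; first by rewrite mup_lam_pencil // mul1n.
rewrite mupNroot // /root hornerD hornerN [(k *: D).[w]]hornerZ -lw -mulrBl.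
by rewrite mulf_neq0 // subr_eq0 eq_sym.
Qed.

Hypothesis rho_nonreal : forall w : C, w ^+ 2 = 1 ->
  n.+1%:R - n.-1%:R * rho * w != 0.

(** If [w = 1] or [w = -1] came from an eigenvalue, [A_1 A_(-1)] would vanish there
    to order at least three, but its derivative there is nonzero. *)
Lemma root_kms_param (w l : C) : w != 0 -> l * D.[w] = N.[w] ->
  root (char_poly (kms n rho)) l -> (D.[w] != 0) && (w ^+ 2 != 1).
Proof.
move=> w0 lw rl.
have D0 : D.[w] != 0.
  apply: contraTneq isT => D0; move/eqP: lw; rewrite D0 mulr0 eq_sym horner_lam_num.
  by rewrite mulf_eq0 (negPf rho12) (negPf w0).
rewrite D0 /=; apply/negP => /eqP w2.
have mrl : (0 < mup l (char_poly (kms n rho)))%N.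
  rewrite -XsubC_dvd ?dvdp_XsubCl //.
  by rewrite -size_poly_gt0 size_char_poly.
have := mup_kms w0 D0 lw; rewrite w2 eqxx => H.
have dB : (A 1 * A (-1))^`().[w] != 0.
  rewrite secular_mul_deriv // !mulf_neq0 ?pnatr_eq0 ?rho_nonreal //.
  by apply: contraNneq D0 => wr; rewrite horner_lam_den wr mulr0.
have B0 : A 1 * A (-1) != 0 by apply: contraNneq dB => ->; rewrite deriv0 horner0.
have [|_] := @mup_ge2 _ w _ B0; first by rewrite -H; lia.
by rewrite /root (negPf dB).
Qed.

Lemma secular_neq0 e : A e != 0.
Proof.
apply/eqP => /(congr1 (fun p : {poly C} => p`_n.+1)); rewrite coef0.
rewrite /secular coefB coefZ coefB coef1 coefZ coefX coefXnM.
rewrite ltnNge leqnSn /= subSnn coefB coefX coefC /=.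
have -> : (n.+1 == 1)%N = false by lia.
by rewrite !mulr0 !subr0 mulr0 subr0; apply/eqP/oner_neq0.
Qed.

Lemma secular_rootE e (w : C) :
  root (A e) w = (w ^+ n * (w - rho) == e * (1 - rho * w)).
Proof. by rewrite /root horner_secular subr_eq0. Qed.

Lemma secular_root_quotient e (w : C) :
  root (A e) w = (w ^+ n.+1 - e == rho * (w ^+ n - e * w)).
Proof.
rewrite secular_rootE -subr_eq0 -[RHS]subr_eq0; congr (_ == 0).
by rewrite exprS; ring.
Qed.

(** If [w = rho] or [rho w = 1], then the two terms of [A_e] cannot cancel. *)
Lemma secular_root_lam_den_neq0 e (w : C) : e ^+ 2 = 1 -> w != 0 ->
  root (A e) w -> D.[w] != 0.
Proof.
move=> e2 w0; rewrite secular_rootE horner_lam_den => Aw.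
have e0 : e != 0 by rewrite -sqrf_eq0 e2 oner_neq0.
have wr : w != rho.
  by apply: contraTneq Aw => ->; rewrite subrr mulr0 eq_sym mulf_neq0.
apply: mulf_neq0; rewrite ?subr_eq0 //.
apply: contraTneq Aw => ->; rewrite subrr mulr0.
by rewrite mulf_neq0 ?subr_eq0 ?expf_neq0.
Qed.

(** [A_e + A_(-e) = 2 w^n (w - rho)] vanishes only where [lam_den] does. *)
Lemma secular_root_exclusive e (w : C) : e ^+ 2 = 1 -> w != 0 ->
  root (A e) w -> ~~ root (A (- e)) w.
Proof.
move=> e2 w0 Aw; have := secular_root_lam_den_neq0 e2 w0 Aw.
rewrite horner_lam_den mulf_eq0 negb_or => /andP[_ wr].
move: Aw; rewrite !secular_rootE => /eqP Aw; apply/eqP => Aw'.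
have : 2%:R * (w ^+ n * (w - rho)) = 0.
  by rewrite mulr_natl mulr2n {1}Aw Aw'; ring.
by apply/eqP; rewrite !mulf_neq0 ?pnatr_eq0 ?expf_neq0.
Qed.

Lemma secular_den_neq0 e (w : C) : e ^+ 2 = 1 -> w ^+ 2 != 1 ->
  root (A e) w -> w ^+ n - e * w != 0.
Proof.
move=> e2 w2; rewrite secular_root_quotient => Aw; apply: contraNneq w2 => E0.
move: Aw; rewrite E0 mulr0 exprS; move/eqP: E0; rewrite subr_eq0 => /eqP ->.
have e0 : e != 0 by rewrite -sqrf_eq0 e2 oner_neq0.
rewrite subr_eq0 => /eqP H; apply/eqP/(mulfI e0).
by rewrite mulr1 -[RHS]H; ring.
Qed.

(** This is [lambda = - e sin(n mu) / sin mu], cleared of denominators. *)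
Lemma secular_root_lam e (w l : C) : e ^+ 2 = 1 -> w != 0 -> w ^+ 2 != 1 ->
  root (A e) w -> l * D.[w] = N.[w] ->
  l * (w ^+ n * (w ^+ 2 - 1)) = - e * (w * (w ^+ (n + n) - 1)).
Proof.
move=> e2 w0 w2 Aw; have E0 := secular_den_neq0 e2 w2 Aw.
move: Aw; rewrite secular_root_quotient horner_lam_num horner_lam_den => /eqP Aw lw.
have e0 : e != 0 by rewrite -sqrf_eq0 e2 oner_neq0.
have W0 : e * (1 - w ^+ 2) != 0 by rewrite mulf_neq0 // subr_eq0 eq_sym.
(* Multiplying by (w^n - e w)^2 makes rho occur only as rho (w^n - e w), which
   the equation of the root turns into w^(n+1) - e. *)
apply: (mulIf W0); have := congr1 ( *%R ((w ^+ n - e * w) ^+ 2)) lw.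
have -> : (w ^+ n - e * w) ^+ 2 * (l * ((1 - rho * w) * (w - rho))) =
  l * ((w ^+ n - e * w) - rho * (w ^+ n - e * w) * w) *
    ((w ^+ n - e * w) * w - rho * (w ^+ n - e * w)) by ring.
have -> : (w ^+ n - e * w) ^+ 2 * ((1 - rho ^+ 2) * w) =
  ((w ^+ n - e * w) ^+ 2 - (rho * (w ^+ n - e * w)) ^+ 2) * w by ring.
rewrite -Aw exprS exprD; move: (w ^+ n) => z.
have -> : (z - e * w) ^+ 2 - (w * z - e) ^+ 2 =
  z ^+ 2 + e ^+ 2 * w ^+ 2 - w ^+ 2 * z ^+ 2 - e ^+ 2 by ring.
rewrite e2 => H.
transitivity (- (l * (z - e * w - (w * z - e) * w)
  * ((z - e * w) * w - (w * z - e)))).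
  by ring.
rewrite H; transitivity (e ^+ 2 * (w * (z * z - 1) * (w ^+ 2 - 1))); last by ring.
by rewrite e2; ring.
Qed.

(** [A_e'' = 0] gives [(n-1) rho = (n+1) w]; substituting into [A_e' = 0] gives
    [w^(n-1) = e], and then [A_e = 0] gives [w^2 = 1]. *)
Lemma secular_double_root_exact e (w : C) : e ^+ 2 = 1 -> w != 0 ->
  w ^+ 2 != 1 -> (mup w (A e) <= 2)%N.
Proof.
move=> e2 w0 w2; rewrite leqNgt; apply/negP => m3.
have e0 : e != 0 by rewrite -sqrf_eq0 e2 oner_neq0.
have [] := mup_ge2 (secular_neq0 e) (ltnW m3).
have := mup_ge3 (secular_neq0 e) m3.
rewrite /root /secular; case: n n2 => [|[|k]] // _.
rewrite !(derivXn, derivXsubC, derivB, derivM, derivC, derivZ, derivX, derivMn, derivD).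
rewrite !(hornerXn, hornerX, hornerC, hornerMn, hornerM, hornerD, hornerN, hornerZ).
(* An opaque name for the cast keeps x *+ j = x * j%:R from rewriting j%:R. *)
have [c cE] : exists c : nat -> C, forall j, c j = j%:R by exists (GRing.natmul 1).
have nc (x : C) j : x *+ j = x * c j by rewrite cE mulr_natr.
rewrite /= !nc !exprS; set z := w ^+ k; have z0 : z != 0 by rewrite expf_neq0.
rewrite !cE -[k.+2%:R]natr1 -[k.+1%:R]natr1; set m : C := k%:R => A2 A0 A1.
have m0 : m + 1 != 0 by rewrite natr1 pnatr_eq0.
have {}A2 : (m + 1) * rho = (m + 3) * w.
  have H : (m + 1 + 1) * z != 0 by rewrite mulf_neq0 // !natr1 pnatr_eq0.
  apply/eqP; rewrite -subr_eq0 -(inj_eq (mulfI H)) mulr0 -oppr_eq0 -(eqP A2).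
  by apply/eqP; ring.
have zw : z * w = e.
  have H : (m + 3) * w != 0 by rewrite mulf_neq0 // -natrD pnatr_eq0 addnS.
  apply/esym/eqP; rewrite -subr_eq0 -(inj_eq (mulfI H)) mulr0.
  rewrite -(mulr0 (m + 1)) -(eqP A1).
  apply/eqP; transitivity ((m + 1) * ((m + 2) * z * w * w + w * w * z)
    - (m + 2) * w * z * ((m + 3) * w) + e * ((m + 3) * w)).
    by ring.
  by rewrite -A2; ring.
move/negP: w2; apply; have H : e * (m + 1) != 0 by rewrite mulf_neq0.
rewrite -subr_eq0 -(inj_eq (mulfI H)) mulr0 -(mulr0 (m + 1)) -(eqP A0).
apply/eqP; transitivity (z * w * w * ((m + 1) * w - (m + 3) * w)
  - e * ((m + 1) - (m + 3) * w * w)).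
  by rewrite zw; ring.
by rewrite -A2; ring.
Qed.

(** The eigenvector is [x_j = w^j - e w^(n+1-j)]; that [A_e] vanishes at [w] is
    what the two corner rows require. *)
Lemma secular_eigenvector e (w l : C) : e ^+ 2 = 1 -> w != 0 -> w ^+ 2 != 1 ->
  root (A e) w -> l * D.[w] = N.[w] ->
  exists y : 'cV[C]_n, [/\ y != 0, kms n rho *m y = l *: y &
    forall j, y (rev_ord j) 0 = - e * y j 0].
Proof.
move=> e2 w0 w2 Aw lw; have D0 := secular_root_lam_den_neq0 e2 w0 Aw.
pose x (j : nat) := w ^+ j - e * w ^+ (n.+1 - j).
exists (\col_j x j.+1); split.
- apply: contraNneq w2 => y0.
  have H j (jn : (j < n)%N) : x j.+1 = 0.
    by have := congr1 (fun y : 'cV_n => y (Ordinal jn) 0) y0; rewrite !mxE.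
  (* From x_1 = x_2 = 0: w = e w^n and w^2 = e w^(n-1), so w^3 = w. *)
  have := H 0%N (ltnW n2); have := H 1%N n2.
  rewrite /x subn1 expr1 (_ : (n.+1 - 2 = n.-1)%N) /=; last by lia.
  move=> /eqP; rewrite subr_eq0 => /eqP W2 /eqP; rewrite subr_eq0 => /eqP W1.
  apply/eqP/(mulfI w0); rewrite mulr1 [RHS]W1 W2 mulrCA -exprS prednK //.
  exact: ltnW.
- apply/(@kms_eigen_tridiag _ _ _ rho21 _ _ (D.[w] / w)).
    by rewrite mulrA lw horner_lam_num mulfK.
  have x0 : rho * x 0%N = rho ^+ 2 * x 1%N.
    rewrite expr2 -mulrA; congr (_ * _); rewrite /x subn0 subn1 /= expr0 expr1.
    move: Aw; rewrite secular_rootE => /eqP Aw.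
    rewrite exprS; apply/eqP; rewrite -subr_eq0; apply/eqP.
    transitivity (1 - rho * w - e * (w ^+ n * (w - rho))); first by ring.
    by rewrite Aw mulrA -expr2 e2; ring.
  have xn : rho * x n.+1 = rho ^+ 2 * x n.
    rewrite expr2 -mulrA; congr (_ * _); rewrite /x subnn subSnn expr0 expr1 mulr1.
    by move: Aw; rewrite secular_root_quotient => /eqP.
  apply/colP => i; rewrite [LHS]mxE [RHS]mxE [in RHS]mxE.
  under eq_bigr do rewrite [(\col__ _) _ _]mxE.
  rewrite tridiag_row // xn subrr mul0rn addr0 horner_lam_den /x.
  have := ltn_ord i; move: (i : nat) => {}i im.
  have -> : (n.+1 - i = (n.-1 - i).+2)%N by lia.
  have -> : (n.+1 - i.+1 = (n.-1 - i).+1)%N by lia.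
  have -> : (n.+1 - i.+2 = n.-1 - i)%N by lia.
  rewrite !exprS; apply: (mulIf w0).
  by rewrite [RHS]mulrAC divfK //; ring.
- move=> j; rewrite !mxE /x /=; have jn := ltn_ord j.
  have -> : ((n - j.+1).+1 = n.+1 - j.+1)%N by lia.
  have -> : (n.+1 - (n.+1 - j.+1) = j.+1)%N by lia.
  by rewrite mulrBr mulrA mulNr mulNr -expr2 e2; ring.
Qed.

(** Eigenspaces are lines, and a line cannot contain both symmetric and
    skew-symmetric nonzero vectors. *)
Lemma kms_eigenvectors_same_parity (e l : C) (y y' : 'cV[C]_n) : l != 0 ->
  y != 0 -> kms n rho *m y = l *: y ->
  (forall j, y (rev_ord j) 0 = - e * y j 0) -> e != 0 ->
  y' != 0 -> kms n rho *m y' = l *: y' ->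
  (forall j, y' (rev_ord j) 0 = e * y' j 0) -> False.
Proof.
move=> l0 y0 Ky ye e0 y'0 Ky' ye'.
have i0 : (0 < n)%N by exact: ltnW.
have lt : l * (l^-1 * (1 - rho ^+ 2)) = 1 - rho ^+ 2 by rewrite mulrA mulfV ?mul1r.
move: Ky Ky' => /(kms_eigen_tridiag rho21 _ lt) Ty /(kms_eigen_tridiag rho21 _ lt) Ty'.
have first0 (z : 'cV[C]_n) : tridiag n rho (1 + rho ^+ 2) (rho ^+ 2) *m z =
    (l^-1 * (1 - rho ^+ 2)) *: z -> z (Ordinal i0) 0 = 0 -> z = 0.
  by move=> Tz; exact: (tridiag_mulmx_eq0 rho0 Tz).
have b0 : y (Ordinal i0) 0 != 0 by apply: contraNneq y0 => /(first0 _ Ty) ->.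
have b0' : y' (Ordinal i0) 0 != 0 by apply: contraNneq y'0 => /(first0 _ Ty') ->.
have Z : y' (Ordinal i0) 0 *: y - y (Ordinal i0) 0 *: y' = 0.
  apply: first0; last by rewrite !mxE mulrC subrr.
  rewrite mulmxBr -!scalemxAr Ty Ty' !scalerA scalerBr !scalerA.
  by congr (_ *: _ - _ *: _); rewrite mulrC.
have := congr1 (fun z : 'cV_n => z (rev_ord (Ordinal i0)) 0) Z.
rewrite !mxE ye ye' => /eqP; apply/negP.
rewrite (_ : _ - _ = - (e * (2%:R * (y' (Ordinal i0) 0 * y (Ordinal i0) 0)))); last by ring.
by rewrite oppr_eq0 !mulf_neq0 // pnatr_eq0.
Qed.

Lemma mup_kms_secular e (w l : C) : e ^+ 2 = 1 -> w != 0 -> w ^+ 2 != 1 ->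
  D.[w] != 0 -> l * D.[w] = N.[w] ->
  mup l (char_poly (kms n rho)) = (mup w (A e) + mup w (A (- e)))%N.
Proof.
move=> e2 w0 w2 D0 lw; have := mup_kms w0 D0 lw.
rewrite (negPf w2) muln1 addn0 => ->; rewrite mupM ?secular_neq0 //.
by move/eqP: e2; rewrite sqrf_eq1 => /orP[] /eqP ->; rewrite ?opprK // addnC.
Qed.

Lemma kms_double_of_secular e (w l : C) : e ^+ 2 = 1 -> w != 0 ->
  w ^+ 2 != 1 -> (2 <= mup w (A e))%N -> l * D.[w] = N.[w] ->
  mup l (char_poly (kms n rho)) = 2%N.
Proof.
move=> e2 w0 w2 m2 lw.
have Aw : root (A e) w by have [] := mup_ge2 (secular_neq0 e) m2.
rewrite (mup_kms_secular e2 w0) // ?(secular_root_lam_den_neq0 e2 w0 Aw) //.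
rewrite [X in (_ + X)%N]mupNroot ?secular_root_exclusive // addn0.
by apply/eqP; rewrite eqn_leq m2 secular_double_root_exact.
Qed.

Lemma secular_double_of_kms e (w l : C) (y : 'cV[C]_n) : e ^+ 2 = 1 ->
  mup l (char_poly (kms n rho)) = 2%N ->
  y != 0 -> kms n rho *m y = l *: y ->
  (forall j, y (rev_ord j) 0 = - e * y j 0) ->
  w != 0 -> l * D.[w] = N.[w] ->
  [/\ w ^+ 2 != 1, root (A e) w & (2 <= mup w (A e))%N].
Proof.
move=> e2 m2 y0 Ky ye w0 lw.
have rl : root (char_poly (kms n rho)) l.
  by apply/negPn/negP => /mupNroot; rewrite m2.
have /andP[D0 w2] := root_kms_param w0 lw rl.
have e0 : e != 0 by rewrite -sqrf_eq0 e2 oner_neq0.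
have me := mup_kms_secular e2 w0 w2 D0 lw.
have Ne2 : (- e) ^+ 2 = 1 by rewrite sqrrN.
have Aw : root (A e) w.
  apply/negPn/negP => nA; have Aw : root (A (- e)) w.
    by apply/negPn/negP => nA'; move: me; rewrite m2 !mupNroot.
  have [y' [y'0 Ky' ye']] := secular_eigenvector Ne2 w0 w2 Aw lw.
  apply: (@kms_eigenvectors_same_parity e l y y') => //.
    exact: eigenvalue_kms_neq0.
  by move=> j; rewrite ye' opprK.
split=> //; move: me; rewrite m2 [X in (_ + X)%N]mupNroot ?addn0 => [<- //|].
exact: secular_root_exclusive.
Qed.

(** The two roots [w] and [1/w] of the quadratic equation for [w] allow the choice
    [|w| <= 1], which corresponds to [v >= 0]. *)
Lemma lam_param_exists (l : C) : l != 0 ->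
  exists w : C, [/\ w != 0, `|w| <= 1 & l * D.[w] = N.[w]].
Proof.
move=> l0; pose s := (1 + rho ^+ 2 - (1 - rho ^+ 2) / l) / rho.
have key (w : C) : w ^+ 2 - s * w + 1 = 0 -> l * D.[w] = N.[w].
  rewrite horner_lam_den horner_lam_num => W.
  have -> : (1 - rho * w) * (w - rho) =
    - rho * (w ^+ 2 - s * w + 1) + (1 + rho ^+ 2 - s * rho) * w by ring.
  by rewrite W mulr0 add0r /s divfK // mulrA; congr (_ * _); field.
pose d := sqrtC (s ^+ 2 - 4).
have dE : d ^+ 2 = s ^+ 2 - 4 by rewrite sqrtCK.
pose w := (s + d) / 2; have W : w ^+ 2 - s * w + 1 = 0.
  rewrite /w; transitivity ((d ^+ 2 - s ^+ 2 + 4) / 4); first by field.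
  by rewrite dE; field.
have w0 : w != 0.
  apply: contraTneq isT => w0; move/eqP: W.
  by rewrite w0 expr0n mulr0 subrr add0r oner_eq0.
have [w1|/ltW w1] := real_leP (normr_real w) (@real1 C); first by exists w; rewrite key.
exists w^-1; rewrite invr_eq0 normfV invf_le1 ?normr_gt0 //; split=> //; apply: key.
apply: (mulIf (expf_neq0 2 w0)); rewrite mul0r -{}[RHS]W.
by field.
Qed.

End KMSMultiplicity.

(** * The function v(n,u) *)
Section Hyperbolic.
Local Open Scope classical_set_scope.
Local Open Scope ring_scope.
Variable R : realType.
Implicit Types (x y u : R) (n : nat).

Definition cosh x : R := (expR x + expR (- x)) / 2.

Lemma expRNM x : expR x * expR (- x) = 1.
Proof. by rewrite -expRD subrr expR0. Qed.

Lemma sinhD x y : sinh (x + y) = sinh x * cosh y + cosh x * sinh y.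
Proof. by rewrite /sinh /cosh opprD !expRD; field. Qed.

Lemma cosh2_sinh2 x : cosh x ^+ 2 - sinh x ^+ 2 = 1.
Proof. by rewrite -[RHS](expRNM x) /cosh /sinh; field. Qed.

Lemma cosh_gt0 x : 0 < cosh x.
Proof. by rewrite divr_gt0 // addr_gt0 ?expR_gt0. Qed.

Lemma sinh_ge_half x : 0 <= x -> x / 2 <= sinh x.
Proof.
move=> x0; rewrite ler_pM2r ?invr_gt0 //.
have := expR_ge1Dx x; have : expR (- x) <= 1 by rewrite -[leRHS]expR0 ler_expR oppr_le0.
lra.
Qed.

Lemma sinh_gt0 x : 0 < x -> 0 < sinh x.
Proof. by move=> x0; apply: lt_le_trans (sinh_ge_half (ltW x0)); lra. Qed.

Lemma sinh0 : sinh 0 = 0 :> R.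
Proof. by rewrite /sinh oppr0 subrr mul0r. Qed.

Lemma sinh_ge0 x : 0 <= x -> 0 <= sinh x.
Proof. by move=> x0; apply: le_trans (sinh_ge_half x0); lra. Qed.

Lemma cosh_ge1 x : 1 <= cosh x.
Proof.
rewrite -(@ler_pXn2r _ 2) ?nnegrE ?(ltW (cosh_gt0 _)) // expr1n.
by have := cosh2_sinh2 x; have := sqr_ge0 (sinh x); lra.
Qed.

Lemma cosh_gt1 x : 0 < x -> 1 < cosh x.
Proof.
move=> x0; rewrite -(@ltr_pXn2r _ 2) ?nnegrE ?(ltW (cosh_gt0 _)) // expr1n.
by have := cosh2_sinh2 x; have := exprn_gt0 2 (sinh_gt0 x0); lra.
Qed.

(** By induction on [n] with [sinh((m+1)x) = sinh(mx) cosh x + cosh(mx) sinh x]: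
    the step reduces to [(m c - 1)(c - 1) >= 0] for [c = cosh x >= 1]. *)
Lemma sinh_natmul_ge n x : (2 <= n)%N -> 0 <= x ->
  n%:R * (sinh x * cosh x) <= sinh (n%:R * x).
Proof.
case: n => [|[|n]] // _ x0; elim: n => [|n IH].
  rewrite (_ : 2%:R * x = x + x); last by ring.
  by rewrite sinhD [cosh x * _]mulrC; lra.
rewrite -[n.+3%:R]natr1 [X in _ <= sinh X]mulrDl mul1r sinhD.
have s0 := sinh_ge0 x0; have c1 := cosh_ge1 x; have cn := cosh_ge1 (n.+2%:R * x).
have m1 : (1 : R) <= n.+2%:R by rewrite ler1n.
move: IH s0 c1 cn m1; move: (sinh (n.+2%:R * x)) (cosh (n.+2%:R * x)) => S K.
move: n.+2%:R => m.
move: (sinh x) (cosh x) => s c IH s0 c1 cn m1.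
have H1 : m * (s * c) * c <= S * c by rewrite ler_wpM2r //; lra.
have H2 : s <= K * s by rewrite ler_peMl.
have H3 : 0 <= s * ((m * c - 1) * (c - 1)).
  by rewrite mulr_ge0 // mulr_ge0 ?subr_ge0 // mulr_ege1.
lra.
Qed.

Lemma sinh_natmul_gt n x : (2 <= n)%N -> 0 < x ->
  n%:R * sinh x < sinh (n%:R * x).
Proof.
move=> n2 x0; apply: lt_le_trans (sinh_natmul_ge n2 (ltW x0)).
by rewrite ltr_pM2l ?ltr0n ?(ltnW n2) // ltr_pMr ?sinh_gt0 // cosh_gt1.
Qed.

(** The left-hand side of the equation [sinh_gap n v = g_n n u] for [v(n,u)]. *)
Definition sinh_gap n x := sinh (n%:R * x) ^+ 2 - n%:R ^+ 2 * sinh x ^+ 2.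

Lemma sinh_sqrB x y : sinh x ^+ 2 - sinh y ^+ 2 = sinh (x + y) * sinh (x - y).
Proof.
rewrite /sinh !opprD !opprK !expRD.
transitivity ((expR x ^+ 2 + expR (- x) ^+ 2 - 2 * (expR x * expR (- x))
  - (expR y ^+ 2 + expR (- y) ^+ 2 - 2 * (expR y * expR (- y)))) / 4); first by field.
rewrite !expRNM.
transitivity ((expR x ^+ 2 * (expR y * expR (- y)) + expR (- x) ^+ 2 * (expR y * expR (- y))
  - (expR x * expR (- x)) * (expR y ^+ 2 + expR (- y) ^+ 2)) / 4); last by field.
by rewrite !expRNM; field.
Qed.

(** By [sinh_sqrB], the increment is a difference of two products,
    [sinh(n p) sinh(n d) - n^2 sinh p sinh d] with [p = y + x], [d = y - x], and
    [sinh(n t) > n sinh t] applies to both factors. *)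
Lemma sinh_gap_lt n x y : (2 <= n)%N -> 0 <= x -> x < y -> sinh_gap n x < sinh_gap n y.
Proof.
move=> n2 x0 xy; rewrite -subr_gt0 /sinh_gap.
have -> : sinh (n%:R * y) ^+ 2 - n%:R ^+ 2 * sinh y ^+ 2 -
    (sinh (n%:R * x) ^+ 2 - n%:R ^+ 2 * sinh x ^+ 2) =
    (sinh (n%:R * y) ^+ 2 - sinh (n%:R * x) ^+ 2)
    - n%:R ^+ 2 * (sinh y ^+ 2 - sinh x ^+ 2) by ring.
rewrite !sinh_sqrB -mulrDr -mulrBr.
have p0 : 0 < y + x by lra.
have d0 : 0 < y - x by lra.
have := sinh_natmul_gt n2 p0; have := sinh_natmul_gt n2 d0.
have := sinh_gt0 p0; have := sinh_gt0 d0.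
have n0 : 0 < n%:R :> R by rewrite ltr0n ltnW.
move: (sinh (n%:R * (y + x))) (sinh (n%:R * (y - x))) (sinh (y + x)) (sinh (y - x)).
move=> P Q p q q0 pp H1 H2.
rewrite subr_gt0 (_ : n%:R ^+ 2 * (p * q) = (n%:R * p) * (n%:R * q)); last by ring.
by apply: ltr_pM => //; rewrite mulr_ge0 // ltW.
Qed.

Lemma sinh_gap_inj n x y : (2 <= n)%N -> 0 <= x -> 0 <= y ->
  sinh_gap n x = sinh_gap n y -> x = y.
Proof.
move=> n2 x0 y0 xy; case: (ltgtP x y) => // h.
  by have := sinh_gap_lt n2 x0 h; rewrite xy ltxx.
by have := sinh_gap_lt n2 y0 h; rewrite xy ltxx.
Qed.

Lemma sinh_gap0 n : sinh_gap n 0 = 0.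
Proof. by rewrite /sinh_gap mulr0 sinh0 expr0n mulr0 subr0. Qed.

#[local] Instance is_derive_sinh x : is_derive x 1 (@sinh R) (cosh x).
Proof.
have -> : @sinh R = (fun y => 2^-1 *: (expR y - expR (- y))).
  by apply/funext => y; rewrite /sinh mulrC.
by apply: is_derive_eq; rewrite /cosh /GRing.scale /=; ring.
Qed.

Lemma is_derive_sinh_gap n x : is_derive x 1 (sinh_gap n)
  (n%:R * (sinh (2 * (n%:R * x)) - n%:R * sinh (2 * x))).
Proof.
have dM : is_derive x 1 (fun y : R => n%:R * y) n%:R.
  have -> : (fun y : R => n%:R * y) = (fun y => n%:R *: y) by [].
  by apply: is_derive_eq; rewrite /GRing.scale /= mulr1.
have dS : is_derive x 1 (fun y : R => sinh (n%:R * y)) (cosh (n%:R * x) * n%:R).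
  exact: (@is_derive1_comp _ (@sinh R) (fun y => n%:R * y)).
have -> : sinh_gap n = (fun y : R => sinh (n%:R * y) ^+ 2 - n%:R ^+ 2 *: sinh y ^+ 2).
  by [].
apply: is_derive_eq; rewrite /GRing.scale /= ?expr1 ?mulr1n.
have d2 y : sinh (2 * y) = 2 * (sinh y * cosh y).
  by rewrite mulr_natl mulr2n sinhD; ring.
by rewrite !d2; ring.
Qed.

(** Intermediate values: [sinh_natmul_ge] gives
    [sinh_gap n x >= n^2 sinh(x)^4], which is unbounded. *)
Lemma sinh_gap_exists n y : (2 <= n)%N -> 0 <= y -> exists2 x, 0 <= x & sinh_gap n x = y.
Proof.
move=> n2 y0; pose b := 2 * (1 + y).
have b0 : 0 <= b by rewrite /b; lra.
have yb : y <= sinh_gap n b.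
  have s0 := sinh_ge0 b0.
  have sb : 1 + y <= sinh b by apply: le_trans (sinh_ge_half b0); rewrite /b; lra.
  have n0 : (0 : R) <= n%:R by [].
  have n1 : (1 : R) <= n%:R by rewrite ler1n ltnW.
  have nb := sinh_natmul_ge n2 b0.
  have nb2 : (n%:R * (sinh b * cosh b)) ^+ 2 <= sinh (n%:R * b) ^+ 2.
    have sc : 0 <= n%:R * (sinh b * cosh b).
      apply: mulr_ge0 => //; apply: mulr_ge0 => //; exact: ltW (cosh_gt0 b).
    by rewrite ler_pXn2r // nnegrE // (le_trans sc).
  apply: le_trans (_ : (n%:R * (sinh b * cosh b)) ^+ 2 - n%:R ^+ 2 * sinh b ^+ 2 <= _).
    have -> : (n%:R * (sinh b * cosh b)) ^+ 2 - n%:R ^+ 2 * sinh b ^+ 2 =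
        (n%:R * sinh b ^+ 2) ^+ 2.
      have cE : cosh b ^+ 2 = 1 + sinh b ^+ 2 by rewrite -(cosh2_sinh2 b); ring.
      transitivity (n%:R ^+ 2 * sinh b ^+ 2 * (cosh b ^+ 2 - 1)); first by ring.
      by rewrite cE; ring.
    have h1 : 1 + y <= (1 + y) ^+ 2 by rewrite expr2 ler_peMl; lra.
    have h2 : (1 + y) ^+ 2 <= sinh b ^+ 2 by rewrite ler_pXn2r ?nnegrE //; lra.
    have h3 : sinh b ^+ 2 <= n%:R * sinh b ^+ 2 by rewrite ler_peMl // sqr_ge0.
    have h4 : n%:R * sinh b ^+ 2 <= (n%:R * sinh b ^+ 2) ^+ 2.
      by rewrite [leRHS]expr2 ler_peMl //; lra.
    lra.
  by rewrite /sinh_gap lerB.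
have [||x] := @IVT _ (sinh_gap n) 0 b y b0.
- apply: continuous_subspaceT => z.
  apply: differentiable_continuous; apply/derivable1_diffP.
  by case: (is_derive_sinh_gap n z).
- by rewrite sinh_gap0 min_l ?max_r ?(le_trans y0) // y0.
- by rewrite in_itv /= => /andP[x0 _] Hx; exists x.
Qed.
End Hyperbolic.

Section ImaginaryPart.
Local Open Scope classical_set_scope.
Local Open Scope ring_scope.
Variables (R : realType) (n : nat).
Hypothesis n2 : (2 <= n)%N.
Implicit Types (u v : R).

Lemma normr_sin_natmul m u : sin u != 0 -> (2 <= m)%N ->
  `|sin (m%:R * u)| < m%:R * `|sin u|.
Proof.
move=> su; have c1 : `|cos u| < 1.
  rewrite -(@ltr_pXn2r _ 2) ?nnegrE // expr1n real_normK ?num_real // cos2sin2.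
  by rewrite ltrBlDr ltrDl exprn_even_gt0.
have s0 : 0 < `|sin u| by rewrite normr_gt0.
case: m => [|[|m]] // _; elim: m => [|m IH].
  rewrite (_ : 2%:R * u = u + u); last by ring.
  rewrite sinD (_ : _ + _ = 2%:R * (sin u * cos u)); last by ring.
  by rewrite normrM normr_nat ltr_pM2l // normrM gtr_pMr.
rewrite -[m.+3%:R]natr1 [(_ + 1) * u]mulrDl mul1r sinD [(_ + 1) * _]mulrDl mul1r.
apply: le_lt_trans (ler_normD _ _) _; rewrite !normrM.
apply: ltr_leD.
  by apply: le_lt_trans IH; rewrite ler_piMr // ltW.
by rewrite ler_piMl // ler_norml cos_geN1 cos_le1.
Qed.

Lemma g_n_gt0 u : sin u != 0 -> 0 < g_n n u.
Proof.
move=> su; rewrite /g_n subr_gt0 -exprMn -[ltLHS]real_normK ?num_real //.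
rewrite -[ltRHS]real_normK ?num_real // normrM normr_nat ltr_pXn2r ?nnegrE ?mulr_ge0 //.
exact: normr_sin_natmul.
Qed.

Lemma sin_eq0_natmul m u : sin u = 0 -> sin (m%:R * u) = 0.
Proof.
move=> su; elim: m => [|m IH]; first by rewrite mul0r sin0.
by rewrite -natr1 mulrDl mul1r sinD IH su mul0r mulr0 addr0.
Qed.

Lemma g_n_eq0 u : sin u = 0 -> g_n n u = 0.
Proof. by move=> su; rewrite /g_n sin_eq0_natmul // su expr0n mulr0 subr0. Qed.

Lemma g_n_ge0 u : 0 <= g_n n u.
Proof. by have [/g_n_eq0 ->|/g_n_gt0/ltW] := eqVneq (sin u) 0. Qed.

Lemma v_nP u : 0 <= v_n n u /\ sinh_gap n (v_n n u) = g_n n u.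
Proof.
have [x x0 Hx] := sinh_gap_exists n2 (g_n_ge0 u).
by rewrite /v_n; case: xgetP => [y -> //|/(_ x)] []; split.
Qed.

Lemma v_n_unique u v : 0 <= v -> sinh_gap n v = g_n n u -> v_n n u = v.
Proof.
by move=> v0 Hv; have [w0 Hw] := v_nP u; apply: (sinh_gap_inj n2 w0 v0); rewrite Hw Hv.
Qed.

Lemma v_n_gt0 u : sin u != 0 -> 0 < v_n n u.
Proof.
move=> su; have [v0 Hv] := v_nP u; rewrite lt_neqAle v0 andbT eq_sym.
by apply: contraTneq (g_n_gt0 su) => V; rewrite -Hv V sinh_gap0 ltxx.
Qed.

Lemma v_n_eq0 u : sin u = 0 -> v_n n u = 0.
Proof. by move=> su; apply: v_n_unique => //; rewrite sinh_gap0 g_n_eq0. Qed.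

(** Near [u], [v_n] is the inverse of [sinh_gap n], whose derivative is positive at
    [v_n n u > 0], composed with [g_n]. *)
Lemma v_n_derivable u : sin u != 0 -> derivable (v_n n) u 1.
Proof.
move=> su; have v0 := v_n_gt0 su; have [_ Hv] := v_nP u.
pose inv y : R := xget 0 [set x : R | 0 <= x /\ sinh_gap n x = y].
have vE : v_n n = inv \o g_n n by [].
have invK x : 0 <= x -> inv (sinh_gap n x) = x.
  move=> x0; rewrite /inv; case: xgetP => [y -> [y0]|/(_ x)]; last by case.
  exact: sinh_gap_inj.
have dinv : is_derive (g_n n u) 1 inv
    (n%:R * (sinh (2 * (n%:R * v_n n u)) - n%:R * sinh (2 * v_n n u)))^-1.
  rewrite -Hv; apply: is_derive_inverse (is_derive_sinh_gap _ _) _.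
  - near=> x; apply: invK; near: x.
    by apply: filterS (lt_nbhsr v0) => x /ltW.
  - near=> x; apply: differentiable_continuous; apply/derivable1_diffP.
    by case: (is_derive_sinh_gap n x).
  - rewrite mulf_neq0 ?pnatr_eq0 -?lt0n ?(ltnW n2) // subr_eq0 gt_eqF //.
    by rewrite [2 * (n%:R * _)]mulrCA sinh_natmul_gt // mulr_gt0.
have dM : is_derive u 1 (fun y : R => n%:R * y) n%:R.
  have -> : (fun y : R => n%:R * y) = (fun y => n%:R *: y) by [].
  by apply: is_derive_eq; rewrite /GRing.scale /= mulr1.
have dS : is_derive u 1 (fun y : R => sin (n%:R * y)) (cos (n%:R * u) * n%:R).
  exact: (@is_derive1_comp _ (@sin R) (fun y => n%:R * y)).
have dg : is_derive u 1 (fun y : R => n%:R ^+ 2 *: sin y ^+ 2 - sin (n%:R * y) ^+ 2)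
    (n%:R ^+ 2 * (sin u * cos u *+ 2) - sin (n%:R * u) * (cos (n%:R * u) * n%:R) *+ 2).
  by apply: is_derive_eq; rewrite /GRing.scale /= ?expr1 ?mulr1n; ring.
rewrite vE; case: (@is_derive1_comp _ inv (g_n n) _ _ _ dinv dg) => + _.
exact.
Unshelve. all: by end_near.
Qed.
End ImaginaryPart.

(** * The quotient f as a rational function of w *)
Section ComplexExponential.
Local Open Scope classical_set_scope.
Local Open Scope ring_scope.
Local Open Scope complex_scope.
Variable R : realType.
Local Notation C := R[i].
Implicit Types z : C.

Lemma expCD z1 z2 : expC (z1 + z2) = expC z1 * expC z2.
Proof.
case: z1 z2 => [a b] [c d]; rewrite /expC /= expRD cosD sinD.
by apply/eqP; rewrite eq_complex /=; apply/andP; split; apply/eqP; ring.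
Qed.

Lemma expC0 : expC 0 = 1 :> C.
Proof. by rewrite /expC /= expR0 cos0 sin0 mul1r. Qed.

Lemma expC_neq0 z : expC z != 0.
Proof.
have : expC z * expC (- z) != 0 by rewrite -expCD subrr expC0 oner_neq0.
by apply: contraNneq => ->; rewrite mul0r.
Qed.

Lemma expCN z : expC (- z) = (expC z)^-1.
Proof.
by apply: (mulfI (expC_neq0 z)); rewrite -expCD subrr expC0 mulfV ?expC_neq0.
Qed.

Lemma expC_natmul n z : expC (n%:R * z) = expC z ^+ n.
Proof.
elim: n => [|n IH]; first by rewrite mul0r expC0.
by rewrite -natr1 [(_ + 1) * z]mulrDl mul1r expCD IH exprSr.
Qed.

Lemma expC_conj z : expC z^*%C = (expC z)^*%C.
Proof.
case: z => a b; rewrite /expC /= cosN sinN.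
by apply/eqP; rewrite eq_complex /=; apply/andP; split; apply/eqP; ring.
Qed.

(** [trig k] is a multiple of [e^(iz) - parity k e^(-iz)], and vectors of type [k]
    satisfy [y_(n+1-j) = - parity k * y_j]. *)
Definition parity k : C := if k == 1%N then 1 else - 1.

Lemma sqr_parity k : parity k ^+ 2 = 1.
Proof. by rewrite /parity; case: ifP; rewrite ?sqrrN expr1n. Qed.

Lemma parity_neq0 k : parity k != 0.
Proof. by rewrite -sqrf_eq0 sqr_parity oner_neq0. Qed.

Lemma imag_neq0 : ('i : C) != 0.
Proof. by rewrite -sqrf_eq0 sqr_i oppr_eq0 oner_neq0. Qed.

Lemma trig_expC k : exists2 c : C, c != 0 &
  forall z, trig k z = c * (expC ('i * z) - parity k / expC ('i * z)).
Proof.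
rewrite /trig /parity; case: ifP => _.
  exists (2 * 'i)^-1; first by rewrite invr_eq0 mulf_neq0 ?pnatr_eq0 ?imag_neq0.
  by move=> z; rewrite /sinC mulrC expCN mul1r.
exists 2^-1; first by rewrite invr_eq0 pnatr_eq0.
by move=> z; rewrite /cosC mulrC expCN mulN1r opprK.
Qed.

Lemma half_angles n z :
  let P := expC ('i * ((n%:R + 1) * z / 2)) in
  let Q := expC ('i * ((n%:R - 1) * z / 2)) in
  P = Q * expC ('i * z) /\ P ^+ 2 = expC ('i * z) ^+ n.+1.
Proof.
split; first by rewrite -expCD; congr expC; field.
by rewrite -!expC_natmul -natr1; congr expC; field.
Qed.

Section Ratio.
Variables (k n : nat) (z : C).
Local Notation w := (expC ('i * z)).
Local Notation e := (parity k).

Lemma f_num_den_exp : exists2 d : C, d != 0 &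
  f_num k n z = d * (w ^+ n.+1 - e) /\ f_den k n z = d * (w ^+ n - e * w).
Proof.
have [c c0 trigE] := trig_expC k; rewrite /f_num /f_den !trigE.
have [] := half_angles n z; set P := expC _; set Q := expC _ => PQ P2.
have P0 : P != 0 := expC_neq0 _; have Q0 : Q != 0 := expC_neq0 _.
have w0 : w != 0 := expC_neq0 _.
exists (c / P); first by rewrite mulf_neq0 ?invr_eq0.
split; first by rewrite -P2; field.
have -> : w ^+ n = P ^+ 2 / w by rewrite P2 exprS mulrAC mulfV ?mul1r.
by rewrite PQ; field; rewrite w0 Q0.
Qed.

Lemma f_num_eq0 : (f_num k n z == 0) = (w ^+ n.+1 - e == 0).
Proof. by have [d d0 [-> _]] := f_num_den_exp; rewrite mulf_eq0 (negPf d0). Qed.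

Lemma f_den_eq0 : (f_den k n z == 0) = (w ^+ n - e * w == 0).
Proof. by have [d d0 [_ ->]] := f_num_den_exp; rewrite mulf_eq0 (negPf d0). Qed.

Lemma f_quotE : f_num k n z / f_den k n z = (w ^+ n.+1 - e) / (w ^+ n - e * w).
Proof.
have [d d0 [-> ->]] := f_num_den_exp.
by rewrite invfM mulrACA divff // mul1r.
Qed.

Lemma f_ratioE : w ^+ n - e * w != 0 ->
  f_ratio k n z = (w ^+ n.+1 - e) / (w ^+ n - e * w).
Proof.
by move=> E0; rewrite /f_ratio f_quotE f_den_eq0 (negPf E0) andbF.
Qed.

End Ratio.

(** Conjugating [z] turns [w] into the inverse of its conjugate, and [w -> 1/w]
    leaves the quotient unchanged. *)
Lemma f_quot_conj k n z :
  f_num k n z^*%C / f_den k n z^*%C = (f_num k n z / f_den k n z)^*%C.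
Proof.
rewrite !f_quotE.
have -> : 'i * z^*%C = (- ('i * z))^*%C.
  case: z => a b; apply/eqP; rewrite eq_complex /=.
  by apply/andP; split; apply/eqP; ring.
rewrite expC_conj expCN; move: (expC_neq0 ('i * z)); move: (expC _) => w w0.
have eC : (parity k)^*%C = parity k.
  by rewrite /parity; case: ifP => _; rewrite ?rmorphN rmorph1.
rewrite fmorph_div !rmorphB rmorphM !rmorphXn /= eC !fmorphV /=.
have : w^*%C != 0 by rewrite fmorph_eq0.
move: (w^*%C) (sqr_parity k) (parity_neq0 k); move: (parity k) => e x e2 e0 x0.
have E1 : x^-1 ^+ n.+1 - e = - e * (x ^+ n.+1 - e) / x ^+ n.+1.
  by rewrite exprVn mulNr mulrBr -expr2 e2 opprB mulrBl mul1r mulfK ?expf_neq0.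
have E2 : x^-1 ^+ n - e / x = - e * (x ^+ n - e * x) / x ^+ n.+1.
  rewrite exprVn mulNr mulrBr mulrA -expr2 e2 mul1r exprS; field.
  by rewrite expf_neq0 // x0.
rewrite E1 E2 -mulf_div divff ?mulr1; last by rewrite invr_eq0 expf_neq0.
by rewrite -mulf_div divff ?mul1r // oppr_eq0.
Qed.

Lemma realP_conj z : reflect (z^*%C = z) (z \is Num.real).
Proof.
case: z => a b; rewrite complex_real; apply: (iffP eqP) => [->|[]] /=; first by rewrite oppr0.
by move=> h; lra.
Qed.

Lemma f_quot_real k n z : z \is Num.real -> f_num k n z / f_den k n z \is Num.real.
Proof. by move/realP_conj => zc; apply/realP_conj; rewrite -f_quot_conj zc. Qed.

(** Points [z + d / 2] with [d] positive are real and arbitrarily close to [z], so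
    the limit is a limit of reals; without a limit, [lim] is the default value
    [0]. *)
Lemma lim_real (f : C -> C) z : z \is Num.real ->
  (forall x, x \is Num.real -> f x \is Num.real) ->
  (lim ((f w : C^o) @[w --> (z : C^o)^']) : C) \is Num.real.
Proof.
move=> zr fr.
have [cf|/dvgP ->] := pselect (cvg ((f w : C^o) @[w --> (z : C^o)^'])); last first.
  exact: real0.
move: cf; set l := lim _ => cf; change (is_true ((l : C) \is Num.real)).
apply/realP_conj/eqP; rewrite -subr_eq0 -normr_le0; apply/ler_addgt0Pl => eps e0.
rewrite addr0; have e20 : 0 < eps / 2 by rewrite divr_gt0.
have /cvgrPdist_lt /(_ _ e20) := cf.
case/nbhs_ballP => d /= d0 H.
have d20 : 0 < d / 2 by rewrite divr_gt0.
have := H (z + d / 2); rewrite /ball /= opprD addrA subrr sub0r normrN gtr0_norm //.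
rewrite gtr_pMr // invf_lt1 // ltr1n => /(_ isT).
rewrite -subr_eq0 addrC addKr gt_eqF // => /(_ isT) L.
have wr : f (z + d / 2) \is Num.real by apply: fr; rewrite rpredD // gtr0_real.
have -> : l^*%C - l = (l - f (z + d / 2))^*%C - (l - f (z + d / 2)).
  by rewrite rmorphB /= (realP_conj _ wr); ring.
apply: le_trans (ler_normB _ _) _.
have -> : `|(l - f (z + d / 2))^*%C| = `|l - f (z + d / 2)| by exact: norm_conjC.
by rewrite [leRHS]splitr; apply: lerD; exact: ltW.
Qed.

Lemma f_ratio_real k n z : z \is Num.real -> f_ratio k n z \is Num.real.
Proof.
move=> zr; rewrite /f_ratio; case: ifP => _; last exact: f_quot_real.
by apply: lim_real => // x; exact: f_quot_real.
Qed.
End ComplexExponential.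

(** * Borderline eigenvalues *)
Section PolarForm.
Local Open Scope classical_set_scope.
Local Open Scope ring_scope.
Local Open Scope complex_scope.
Variable R : realType.
Local Notation C := R[i].
Implicit Types (u v : R).

Lemma mul_imag u v : 'i * (u +i* v) = (- v) +i* u :> C.
Proof. by apply/eqP; rewrite eq_complex /=; apply/andP; split; apply/eqP; ring. Qed.

Lemma expC_imagE u v :
  expC ('i * (u +i* v)) = (expR (- v) * cos u) +i* (expR (- v) * sin u) :> C.
Proof.
rewrite mul_imag /expC /=.
by apply/eqP; rewrite eq_complex /=; apply/andP; split; apply/eqP; ring.
Qed.

(** This is [|2 sin mu|^2 = 4 (sin^2 u + sinh^2 v)] for [mu = u + i v]. *)
Lemma norm_expC_subV u v (w := expC ('i * (u +i* v)) : C) :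
  `|w - w^-1| ^+ 2 = (4 * (sin u ^+ 2 + sinh v ^+ 2))%:C.
Proof.
rewrite -expCN (_ : - ('i * (u +i* v)) = 'i * ((- u) +i* (- v))); last first.
  by apply/eqP; rewrite eq_complex /=; apply/andP; split; apply/eqP; ring.
rewrite /w !expC_imagE cosN sinN opprK -add_Re2_Im2 /=; congr (_%:C).
have := cos2Dsin2 u; have := expRNM v; rewrite /sinh.
move: (cos u) (sin u) (expR v) (expR (- v)) => c s p q pq cs.
transitivity ((p * p + q * q) * (c ^+ 2 + s ^+ 2) - 2 * (p * q) * (c ^+ 2 - s ^+ 2)).
  by ring.
have cE : c ^+ 2 = 1 - s ^+ 2 by rewrite -cs; ring.
rewrite cE pq; transitivity (p * p + q * q - 2 + 4 * s ^+ 2); first by ring.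
by rewrite -[2 in LHS]mulr1 -{1}pq; field.
Qed.

(** Taking squared norms in [lambda sin mu = - e sin(n mu)] turns [|lambda| = n]
    into [n^2 (sin^2 u + sinh^2 v) = sin^2(n u) + sinh^2(n v)]. *)
Lemma borderline_iff n k (rho l : C) u v (w := expC ('i * (u +i* v)) : C) :
  rho ^+ 2 != 1 -> w ^+ 2 != 1 ->
  root (secular n rho (parity R k)) w ->
  l * (lam_den rho).[w] = (lam_num rho).[w] ->
  `|l| = n%:R <-> sinh_gap n v = g_n n u.
Proof.
move=> rho21 w2 Aw lw.
have w0 : w != 0 := expC_neq0 _.
have := secular_root_lam (sqr_parity R k) w0 w2 Aw lw.
have wV : w - w^-1 != 0.
  by apply: contraNneq w2 => H; rewrite expr2 -{2}[w](subrK w^-1) H add0r mulfV.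
have -> : l * (w ^+ n * (w ^+ 2 - 1)) = l * (w - w^-1) * (w ^+ n * w) by field.
have -> : - parity R k * (w * (w ^+ (n + n) - 1)) =
    - parity R k * (w ^+ n - (w ^+ n)^-1) * (w ^+ n * w).
  by rewrite exprD; field; rewrite expf_neq0.
move/mulIf; rewrite mulf_neq0 ?expf_neq0 // => /(_ isT) L.
have E1 : w ^+ n = expC ('i * ((n%:R * u) +i* (n%:R * v))).
  rewrite -expC_natmul; congr expC.
  rewrite mulrCA; congr (_ * _).
  apply/eqP; rewrite eq_complex /= ; apply/andP.
  have -> : (n%:R : C) = (n%:R : R)%:C by rewrite rmorph_nat.
  by rewrite /=; split; apply/eqP; ring.
rewrite E1 in L; have := congr1 (fun x => `|x| ^+ 2) L.
rewrite /= !normrM !exprMn !norm_expC_subV normrN.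
have -> : `|parity R k| ^+ 2 = 1 by rewrite -normrX sqr_parity normr1.
rewrite mul1r => H.
have S0 : 4 * (sin u ^+ 2 + sinh v ^+ 2) != 0.
  apply: contraNneq wV => S; have := norm_expC_subV u v; rewrite S.
  by move/eqP; rewrite sqrf_eq0 normr_eq0.
have nC : (n%:R : C) = (n%:R : R)%:C by rewrite rmorph_nat.
have HE : sinh_gap n v = g_n n u <->
    n%:R ^+ 2 * (4 * (sin u ^+ 2 + sinh v ^+ 2)) =
    4 * (sin (n%:R * u) ^+ 2 + sinh (n%:R * v) ^+ 2).
  by rewrite /sinh_gap /g_n; split => ?; lra.
rewrite HE; split=> [ln|HH].
  apply: complexI; rewrite -H ln nC.
  by rewrite [LHS]rmorphM rmorphXn.
have : `|l| ^+ 2 = n%:R ^+ 2.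
  apply: (mulIf (_ : (4 * (sin u ^+ 2 + sinh v ^+ 2))%:C != 0)).
    by rewrite -[0]/(0%:C) (inj_eq (@complexI _)).
  by rewrite H -HH nC [LHS]rmorphM rmorphXn.
by move/eqP; rewrite eqrXn2 // => /eqP.
Qed.

Lemma polar_exists (w : C) : w != 0 -> `|w| <= 1 ->
  exists u v, [/\ - pi <= u <= pi, 0 <= v & w = expC ('i * (u +i* v))].
Proof.
case: w => a b w0; rewrite normc_def /= => w1.
set r := Num.sqrt (a ^+ 2 + b ^+ 2) in w1.
have r1 : r <= 1 by move: w1; rewrite -[1]/(1%:C) lecR.
have ab0 : 0 < a ^+ 2 + b ^+ 2.
  rewrite lt_neqAle addr_ge0 ?sqr_ge0 // andbT eq_sym paddr_eq0 ?sqr_ge0 // !sqrf_eq0.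
  by move: w0; rewrite eq_complex.
have r0 : 0 < r by rewrite sqrtr_gt0.
have r2 : r ^+ 2 = a ^+ 2 + b ^+ 2 by rewrite sqr_sqrtr // ltW.
have cs : (a / r) ^+ 2 + (b / r) ^+ 2 = 1.
  by rewrite !exprMn -mulrDl -r2 -exprMn divff ?expr1n // gt_eqF.
have c1 : -1 <= a / r <= 1.
  rewrite -ler_norml -(@ler_pXn2r _ 2) ?nnegrE // expr1n real_normK ?num_real //.
  by rewrite -cs lerDl sqr_ge0.
have sE : sin (acos (a / r)) = `|b / r|.
  by rewrite sin_acos // -cs addrC addKr sqrtr_sqr.
have [p0 ppi] : 0 <= acos (a / r) /\ acos (a / r) <= pi by rewrite acos_ge0 // acos_lepi.
have E : expR (- - ln r) = r by rewrite opprK lnK.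
have lr : 0 <= - ln r by rewrite oppr_ge0 ln_le0.
have rn : r != 0 by rewrite gt_eqF.
have [b0|b0] := leP 0 b.
  exists (acos (a / r)), (- ln r); split=> //; first by rewrite ppi andbT; lra.
  rewrite expC_imagE E acosK ?in_itv //= sE ger0_norm ?divr_ge0 // ?ltW //.
  by rewrite mulrC divfK // mulrC divfK.
exists (- acos (a / r)), (- ln r); split=> //; first by apply/andP; split; lra.
rewrite expC_imagE E cosN sinN acosK ?in_itv //= sE ltr0_norm; last first.
  by rewrite pmulr_llt0 // invr_gt0.
by rewrite opprK mulrC divfK // mulrC divfK.
Qed.

End PolarForm.

(** * Differentiation along the curve *)
Section ComplexLimits.
Local Open Scope classical_set_scope.
Local Open Scope ring_scope.
Local Open Scope complex_scope.
Variable R : realType.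
Local Notation C := R[i].

Lemma cvg_real_complex (T : Type) (F : set_system T) {FF : Filter F}
    (f : T -> R) (a : R) :
  f t @[t --> F] --> a -> ((f t)%:C : C^o) @[t --> F] --> (a%:C : C^o).
Proof.
move=> fa; apply/cvgrPdist_lt => eps.
case: eps => x y; rewrite ltcE /= => /andP[/eqP -> x0].
move/cvgrPdist_lt: fa => /(_ _ x0); apply: filterS => t ht.
by rewrite -rmorphB normc_def /= expr0n addr0 sqrtr_sqr ltcR.
Qed.

Lemma cvg_complex (T : Type) (F : set_system T) {FF : Filter F}
    (f g : T -> R) (a b : R) :
  f t @[t --> F] --> a -> g t @[t --> F] --> b ->
  ((f t +i* g t : C^o) @[t --> F] --> (a +i* b : C^o)).
Proof.
move=> fa gb.
have E x y : x +i* y = x%:C + 'i * y%:C :> C.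
  by apply/eqP; rewrite eq_complex /=; apply/andP; split; apply/eqP; ring.
under eq_fun do rewrite E.
rewrite E; apply: (@cvgD _ (C^o)); first exact: cvg_real_complex.
by apply: (@cvgM C); [exact: cvg_cst|exact: cvg_real_complex].
Qed.

Lemma cvg_horner (T : Type) (F : set_system T) {FF : Filter F}
    (f : T -> C) (a : C) (p : {poly C}) :
  ((f t : C^o) @[t --> F] --> (a : C^o)) ->
  ((p.[f t] : C^o) @[t --> F] --> (p.[a] : C^o)).
Proof.
move=> fa; elim/poly_ind: p => [|p c IH].
  by under eq_fun do rewrite horner0; rewrite horner0; exact: cvg_cst.
under eq_fun do rewrite hornerMXaddC.
rewrite hornerMXaddC; apply: (@cvgD _ (C^o)); last exact: cvg_cst.
exact: (@cvgM C T F FF (fun t => p.[f t]) f p.[a] a IH fa).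
Qed.

Lemma is_derive_quot (f : R -> R) (u d : R) : is_derive u 1 f d ->
  (f (u + h) - f u) / h @[h --> (0 : R)^'] --> d.
Proof.
case=> df <-; rewrite /derive.
have -> : (fun h => (f (u + h) - f u) / h) =
    (fun h => h^-1 *: ((f \o shift u) (h *: 1) - f u)).
  by apply/funext => h; rewrite /= /GRing.scale /= mulr1 [h + u]addrC mulrC.
exact: df.
Qed.
End ComplexLimits.

Section Derivative.
Local Open Scope classical_set_scope.
Local Open Scope ring_scope.
Local Open Scope complex_scope.
Variables (R : realType) (n : nat).
Hypothesis n2 : (2 <= n)%N.
Local Notation C := R[i].
Implicit Types u : R.

Definition exp_i_mu u : C := expC ('i * mu_n n u).

Lemma exp_i_muE u :
  exp_i_mu u = (expR (- v_n n u) * cos u) +i* (expR (- v_n n u) * sin u).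
Proof. exact: expC_imagE. Qed.

Lemma exp_i_mu_neq0 u : exp_i_mu u != 0. Proof. exact: expC_neq0. Qed.

(** The derivative is [i mu'(u) e^(i mu)] and [mu' = 1 + i v'] is never zero. *)
Lemma exp_i_mu_derivative u : sin u != 0 ->
  exists2 om : C, om != 0 & has_derivative exp_i_mu u om.
Proof.
move=> su; have dv : is_derive u 1 (v_n n) ('D_1 (v_n n) u).
  by split=> //; exact: v_n_derivable.
set d := 'D_1 (v_n n) u in dv; pose r := expR (- v_n n u).
have r0 : r != 0 by rewrite gt_eqF ?expR_gt0.
have dr : is_derive u 1 (fun y => expR (- v_n n y)) (r * (- d)).
  exact: (@is_derive1_comp _ (@expR R) (fun y => - v_n n y)).
have dRe : is_derive u 1 (fun y => expR (- v_n n y) * cos y) (r * (- d * cos u - sin u)).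
  by apply: is_derive_eq; rewrite /GRing.scale /= -/r; ring.
have dIm : is_derive u 1 (fun y => expR (- v_n n y) * sin y) (r * (- d * sin u + cos u)).
  by apply: is_derive_eq; rewrite /GRing.scale /= -/r; ring.
exists ((r * (- d * cos u - sin u)) +i* (r * (- d * sin u + cos u))).
  apply/eqP => /eqP; rewrite eq_complex /= !mulf_eq0 (negPf r0) /= => /andP[/eqP a /eqP b].
  have := cos2Dsin2 u.
  have : (- d * cos u - sin u) ^+ 2 + (- d * sin u + cos u) ^+ 2 =
    (d ^+ 2 + 1) * (cos u ^+ 2 + sin u ^+ 2) by ring.
  rewrite a b => + cs; rewrite cs expr0n addr0 mulr1 => /eqP; rewrite eq_sym gt_eqF //.
  by rewrite ltr_wpDl // sqr_ge0.
rewrite /has_derivative.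
have -> : (fun h => (exp_i_mu (u + h) - exp_i_mu u) / h%:C : C^o) =
   (fun h => ((expR (- v_n n (u + h)) * cos (u + h) - expR (- v_n n u) * cos u) / h)
     +i* ((expR (- v_n n (u + h)) * sin (u + h) - expR (- v_n n u) * sin u) / h)).
  apply/funext => h; rewrite !exp_i_muE -fmorphV.
  by apply/eqP; rewrite eq_complex /=; apply/andP; split; apply/eqP; ring.
apply: cvg_complex.
- exact: (@is_derive_quot _ (fun y => expR (- v_n n y) * cos y)).
- exact: (@is_derive_quot _ (fun y => expR (- v_n n y) * sin y)).
Qed.

Lemma has_derivative_unique (phi : R -> C) u (l l' : C) :
  has_derivative phi u l -> has_derivative phi u l' -> l = l'.
Proof.
have PF : ProperFilter (0 : R)^' by exact: _.
exact: (@norm_cvg_unique _ (C^o) _ (fmap_proper_filter _ PF)).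
Qed.

Lemma derivative_cvg (phi : R -> C) u (l : C) : has_derivative phi u l ->
  ((phi (u + h) : C^o) @[h --> (0 : R)^'] --> (phi u : C^o)).
Proof.
move=> dphi; have h0 : ((h%:C : C^o) @[h --> (0 : R)^'] --> ((0 : R)%:C : C^o)).
  by apply: cvg_real_complex; exact: cvg_within.
have FF : Filter (0 : R)^' by exact: dnbhs_filter.
have := @cvgM C R (0 : R)^' FF (fun h => (phi (u + h) - phi u) / h%:C)
  (fun h => h%:C) l (0 : R)%:C dphi h0.
rewrite mulr0 => H.
have H2 := @cvgD C (C^o) R (0 : R)^' FF _ _ _ _ H (@cvg_cst (C^o) (phi u) R (0 : R)^' FF).
rewrite add0r in H2.
pose G h := (phi (u + h) - phi u) / h%:C * h%:C + phi u.
have {}H2 : (G h : C^o) @[h --> (0 : R)^'] --> (phi u : C^o) by exact: H2.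
apply: cvg_trans H2; apply: near_eq_cvg.
near=> h; have h1 : h != 0 by near: h; exact: nbhs_dnbhs_neq.
by rewrite /G divfK ?subrK //; move: h1; rewrite -(inj_eq (@complexI R)).
Unshelve. all: by end_near.
Qed.

Lemma exp_i_mu_sqr_neq1 u : sin u != 0 -> exp_i_mu u ^+ 2 != 1.
Proof.
move=> su; apply/eqP => w2.
have := congr1 (fun z => `|z|) w2; rewrite normrX normr1 -add_Re2_Im2 exp_i_muE /=.
set r := expR _; have rlt : r < 1 by rewrite /r -[ltRHS]expR0 ltr_expR oppr_lt0 v_n_gt0.
have r0 : 0 < r by rewrite expR_gt0.
have -> : (r * cos u) ^+ 2 + (r * sin u) ^+ 2 = r ^+ 2 * (cos u ^+ 2 + sin u ^+ 2).
  by ring.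
rewrite cos2Dsin2 mulr1 => /(@complexI _ _ 1) r2.
have : r ^+ 2 < 1 by rewrite expr_lt1 ?ltW.
by rewrite r2 ltxx.
Qed.

Lemma f_n_exp_i_mu (k : nat) u : exp_i_mu u ^+ n - parity R k * exp_i_mu u != 0 ->
  f_n k n u =
  (exp_i_mu u ^+ n.+1 - parity R k) / (exp_i_mu u ^+ n - parity R k * exp_i_mu u).
Proof. exact: f_ratioE. Qed.

(** If [sin u = 0] then [v = 0] and [mu] is real.  If the denominator alone
    vanishes, the quotient is [0] by convention; if the numerator vanishes too,
    then [w^2 = 1], which [sin u <> 0] excludes because then [|w| < 1]. *)
Lemma f_n_nonreal (k : nat) u : f_n k n u \isn't Num.real ->
  sin u != 0 /\ exp_i_mu u ^+ n - parity R k * exp_i_mu u != 0.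
Proof.
move=> fr; have su : sin u != 0.
  apply: contraNneq fr => su; apply: f_ratio_real.
  by rewrite /mu_n v_n_eq0 // complex_real.
split=> //; apply: contraNneq fr => E0.
have d0 : f_den k n (mu_n n u) = 0 by apply/eqP; rewrite f_den_eq0 E0.
rewrite /f_n /f_ratio d0 eqxx andbT f_num_eq0 -/(exp_i_mu u).
case: ifP => [/eqP N0|_]; last by rewrite invr0 mulr0 real0.
have := exp_i_mu_sqr_neq1 su; rewrite -(inj_eq (mulfI (parity_neq0 R k))) mulr1.
move: N0; rewrite exprS; move/eqP: E0; rewrite subr_eq0 => /eqP ->.
move/eqP; rewrite subr_eq0 => /eqP H; rewrite -[X in _ != X]H.
by rewrite expr2 mulrCA eqxx.
Qed.

(** [f - rho = A_e(w) / (w^n - e w)] with [rho] the value at [u], and [A_e] is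
    [q] times the increment of [w]. *)
Lemma f_n_derivative (k : nat) u (q : {poly C}) : sin u != 0 ->
  exp_i_mu u ^+ n - parity R k * exp_i_mu u != 0 ->
  secular n (f_n k n u) (parity R k) = q * ('X - (exp_i_mu u)%:P) ->
  exists2 om : C, om != 0 & has_derivative (f_n k n) u
    (q.[exp_i_mu u] * (exp_i_mu u ^+ n - parity R k * exp_i_mu u)^-1 * om).
Proof.
move=> su E0 Aq; have [om om0 dw] := exp_i_mu_derivative su; exists om; first exact: om0.
set e := parity R k in E0 Aq *; set rho := f_n k n u in Aq *.
pose E : {poly C} := 'X^n - e *: 'X.
have EE w : E.[w] = w ^+ n - e * w by rewrite /E !hornerE.
have FF : Filter (0 : R)^' by exact: dnbhs_filter.
have wc := derivative_cvg dw.
have qc := @cvg_horner R R (0 : R)^' FF _ _ q wc.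
have Ec := @cvg_horner R R (0 : R)^' FF _ _ E wc.
have Ewn : E.[exp_i_mu u] != 0 by rewrite EE.
have Vc := @cvgV C R (0 : R)^' FF _ _ Ewn Ec.
have M1 := @cvgM C R (0 : R)^' FF _ _ _ _ qc Vc.
have M2 := @cvgM C R (0 : R)^' FF _ _ _ _ M1 dw.
pose G h := q.[exp_i_mu (u + h)] * (E.[exp_i_mu (u + h)])^-1
  * ((exp_i_mu (u + h) - exp_i_mu u) / h%:C).
have {}M2 : (G h : C^o) @[h --> (0 : R)^'] -->
    (q.[exp_i_mu u] * (E.[exp_i_mu u])^-1 * om : C^o).
  exact: M2.
rewrite -EE /has_derivative; apply: cvg_trans M2; apply: near_eq_cvg.
have nz := @cvgr_neq0 C (C^o) R (0 : R)^' FF _ _ Ec Ewn.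
near=> h; have Eh : E.[exp_i_mu (u + h)] != 0 by near: h; exact: nz.
rewrite /G mulrA; congr (_ / _); rewrite f_n_exp_i_mu -?EE //.
have := congr1 (fun p => p.[exp_i_mu (u + h)]) Aq.
rewrite hornerM hornerXsubC horner_secular => H.
rewrite mulrAC -H; apply: (mulIf Eh); rewrite divfK // [RHS]mulrBl divfK //.
by rewrite EE exprS /rho /e; ring.
Unshelve. all: by end_near.
Qed.
End Derivative.

(** * Singularities and double eigenvalues *)
Section Main.
Local Open Scope classical_set_scope.
Local Open Scope ring_scope.
Local Open Scope complex_scope.
Variables (R : realType) (n : nat).
Local Notation C := R[i].

Lemma nonreal_neq0 (rho : C) : rho \isn't Num.real -> rho != 0.
Proof. by apply: contraNneq => ->; rewrite real0. Qed.

Lemma nonreal_sqr_neq1 (rho : C) : rho \isn't Num.real -> rho ^+ 2 != 1.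
Proof.
by apply: contraNN; rewrite sqrf_eq1 => /orP[] /eqP ->; rewrite ?rpredN real1.
Qed.

Lemma nonreal_edge (rho w : C) : (2 <= n)%N -> rho \isn't Num.real -> w ^+ 2 = 1 ->
  n.+1%:R - n.-1%:R * rho * w != 0.
Proof.
move=> n2 rr w2; apply: contraNneq rr => /eqP; rewrite subr_eq0 => /eqP H.
have n1 : n.-1%:R != 0 :> C by rewrite pnatr_eq0; lia.
have -> : rho = n.+1%:R * w / n.-1%:R.
  by rewrite H -[_ * w * w]mulrA -expr2 w2 mulr1 mulrAC mulfV ?mul1r.
have wr : w \is Num.real.
  by move/eqP: w2; rewrite sqrf_eq1 => /orP[] /eqP ->; rewrite ?rpredN real1.
by rewrite realM ?realV ?realM ?realn.
Qed.

Lemma of_typeE k (rho l : C) : of_type n k rho l <->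
  exists y : 'cV[C]_n, [/\ y != 0, kms n rho *m y = l *: y &
    forall j, y (rev_ord j) 0 = - parity R k * y j 0].
Proof.
rewrite /of_type /parity; case: ifP => _.
  by split=> -[y [y0 Ky ye]]; exists y; split=> // j; rewrite ye ?mulN1r.
by split=> -[y [y0 Ky ye]]; exists y; split=> // j; rewrite ye ?opprK ?mul1r.
Qed.
End Main.

Unset Implicit Arguments.
Local Open Scope complex_scope.

Theorem theorem5p2 (R : realType) (n : nat) (hn : (2 <= n)%N)
    (k : nat) (hk : k = 1%N \/ k = 2%N)
    (rho0 : R[i]) (hrho0 : rho0 \isn't Num.real) :
  is_singularity k n rho0 <->
  exists lambda : R[i],
    borderline_double n rho0 lambda /\ of_type n k rho0 lambda.
Proof.
have r0 := nonreal_neq0 hrho0; have r2 := nonreal_sqr_neq1 hrho0.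
have re w := @nonreal_edge R n rho0 w hn hrho0.
have e2 := sqr_parity R k.
split=> [[u [_ fu df]]|[l [[[Kl ln] ml] /of_typeE[y [y0 Ky ye]]]]].
  have [su E0] : sin u != 0 /\ exp_i_mu n u ^+ n - parity R k * exp_i_mu n u != 0.
    by apply: f_n_nonreal => //; rewrite fu.
  have w0 := exp_i_mu_neq0 n u; have w2 := exp_i_mu_sqr_neq1 hn su.
  have Aw : root (secular n rho0 (parity R k)) (exp_i_mu n u).
    by rewrite secular_root_quotient -fu f_n_exp_i_mu // divfK.
  have [q Aq] := factor_theorem _ _ Aw.
  have [om om0 df'] : exists2 om : R[i], om != 0 & has_derivative (f_n k n) u
      (q.[exp_i_mu n u] * (exp_i_mu n u ^+ n - parity R k * exp_i_mu n u)^-1 * om).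
    by apply: f_n_derivative => //; rewrite fu.
  have q0 : root q (exp_i_mu n u).
    have /esym/eqP := has_derivative_unique df df'.
    by rewrite !mulf_eq0 invr_eq0 (negPf E0) (negPf om0) !orbF.
  have m2 : (2 <= mup (exp_i_mu n u) (secular n rho0 (parity R k)))%N.
    have [q' qq] := factor_theorem _ _ q0.
    by rewrite mup_geq ?secular_neq0 // Aq qq -mulrA -expr2 dvdp_mull.
  have D0 := secular_root_lam_den_neq0 r2 e2 w0 Aw.
  pose l := (lam_num rho0).[exp_i_mu n u] / (lam_den rho0).[exp_i_mu n u].
  have lw : l * (lam_den rho0).[exp_i_mu n u] = (lam_num rho0).[exp_i_mu n u].
    by rewrite divfK.
  have ml := kms_double_of_secular hn r0 r2 e2 w0 w2 m2 lw.
  exists l; split; last first.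
    by apply/of_typeE; exact: (secular_eigenvector hn r0 r2 e2 w0 w2 Aw lw).
  split=> //; split.
    rewrite eigenvalue_root_char; apply/negPn/negP => /mupNroot.
    by rewrite ml.
  by apply/(borderline_iff r2 w2 Aw lw); have [] := v_nP hn u.
have l0 : l != 0.
  by apply: (eigenvalue_kms_neq0 (n := n) r2); rewrite -eigenvalue_root_char; exact: Kl.
have [w [w0 w1 lw]] := lam_param_exists r0 l0.
have [w2 Aw m2] := secular_double_of_kms hn r0 r2 re e2 ml y0 Ky ye w0 lw.
have [u [v [upi v0 wE]]] := polar_exists w0 w1.
have hv : sinh_gap n v = g_n n u.
  by move: w2 Aw lw; rewrite wE => w2 Aw lw; exact: (borderline_iff r2 w2 Aw lw).1.
have vE : v_n n u = v by exact: v_n_unique.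
have wu : exp_i_mu n u = w by rewrite /exp_i_mu /mu_n vE wE.
have E0 := secular_den_neq0 e2 w2 Aw.
have fu : f_n k n u = rho0.
  rewrite f_n_exp_i_mu wu //; move: Aw; rewrite secular_root_quotient => /eqP ->.
  by rewrite mulfK.
exists u; split=> //.
have [su _] : sin u != 0 /\ exp_i_mu n u ^+ n - parity R k * exp_i_mu n u != 0.
  by apply: f_n_nonreal => //; rewrite fu.
move: m2; rewrite mup_geq ?secular_neq0 // => /dvdpP[q Aq].
have [om _] : exists2 om : R[i], om != 0 & has_derivative (f_n k n) u
   ((q * ('X - w%:P)).[exp_i_mu n u]
    * (exp_i_mu n u ^+ n - parity R k * exp_i_mu n u)^-1 * om).
  by apply: f_n_derivative => //; rewrite ?wu // fu Aq expr2 mulrA.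
by rewrite hornerM hornerXsubC wu subrr mulr0 !mul0r.
Qed.
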